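(* Let $\{H_1,\dots,H_m,E_1,\dots,E_n\}$ be a collection of $m\ge 2$ hyperbolic and $n\ge 0$ elliptic transformations in $\mathrm{PGL}_3(\mathbb{C})$, each without repeated eigenvalues and with generic eigenvalues. Let $A,C$ be an eigendirection flag pair of $H_1$ and $B,D$ an eigendirection flag pair of $H_2$, with $A,B,C,D$ in generic position, and suppose that each remaining element $M$ of the collection has an eigendirection flag pair $\beta,\beta'$ such that $A,\beta,C,D$ are in generic position and $A,\beta',C,D$ are in generic position. Then the collection is simultaneously conjugate into $\mathrm{PGL}_3(\mathbb{R})$ if and only if: (a) the two cross ratios coming from $[A,B,C,D]$ are real; (b) the two triple ratios $r_3(A,B,C)$ and $r_3(A,C,D)$ are real; for each $M=H_i$ with $i>2$, with flag pair $\beta,\beta'$: (c) the two cross ratios coming from $[A,\beta,C,D]$ are real; (d) the two cross ratios coming from $[A,\beta',C,D]$ are real; (e) the triple ratios $r_3(A,\beta,C)$ and $r_3(A,\beta',C)$ are real; and for each $M=E_i$, with flag pair $\beta,\beta'$: (f) the two cross ratios coming from $[A,\beta,C,D]$ are the complex conjugates of the respective two cross ratios coming from $[A,\beta',C,D]$; (g) $r_3(A,\beta,C)=\overline{r_3(A,\beta',C)}$.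
   Context: $\mathrm{PGL}_3(\mathbb{R})$ is regarded as the image of $\mathrm{GL}_3(\mathbb{R})$ in $\mathrm{PGL}_3(\mathbb{C})$. A collection $\{M_j\}$ is simultaneously conjugate into $\mathrm{PGL}_3(\mathbb{R})$ if a single $\Gamma\in\mathrm{PGL}_3(\mathbb{C})$ satisfies $\Gamma^{-1}M_j\Gamma\in\mathrm{PGL}_3(\mathbb{R})$ for all $j$. Types. The eigenvalues of (a representative of) $M\in \mathrm{PGL}_3(\mathbb{C})$ are $\mathrm{PGL}_3(\mathbb{R})$-compatible if there is a real line $\ell$ through $0$ in $\mathbb{C}$ such that every eigenvalue lies in $\ell$ or is swapped with another eigenvalue by reflection about $\ell$. Eigenvalues in $\ell$ (and their eigendirections) are hyperbolic, those swapped in pairs are elliptic (and their two eigendirections form an elliptic pair). $M\in\mathrm{PGL}_3(\mathbb{C})$ is called hyperbolic if all three eigenvalues lie in $\ell$, and elliptic if it has two elliptic eigenvalues (swapped by the reflection) and one hyperbolic eigenvalue. Generic eigenvalues: no repeated eigenvalues, no two eigenvalues both contained in a line through $0$ and swapped by reflection about a line through $0$, and the hyperbolic/elliptic labelling does not depend on the choice of $\ell$. Flags. A flag $F$ in $\mathbb{C}^3$ is $0\subsetneq F_1\subsetneq F_2\subsetneq\mathbb{C}^3$ with $\dim F_j=j$. If $M$ has eigendirections $m_1,m_2,m_3$ (in some order, but for elliptic $M$ with $m_1,m_3$ the elliptic pair), the eigendirection flag pair is $\beta=(\langle m_1\rangle\subset\langle m_1\rangle\oplus\langle m_2\rangle)$,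 $\beta'=(\langle m_3\rangle\subset\langle m_3\rangle\oplus\langle m_2\rangle)$. Flags $A,B,\dots,Z$ in $\mathbb{C}^k$ are in generic position if $A_{i_A}\oplus B_{i_B}\oplus\cdots\oplus Z_{i_Z}=\mathbb{C}^k$ whenever $i_A,\dots,i_Z\ge0$ and $i_A+\dots+i_Z=k$. Cross ratios. In $\mathbb{C}P^1=\mathbb{C}\cup\{\infty\}$, $[a,b,c,d]=\frac{(a-d)(c-b)}{(a-b)(c-d)}$. For flags $A,B,C,D$ in generic position in $\mathbb{C}^3$, the two cross ratios coming from $[A,B,C,D]$ are, for $(i,j)=(1,0)$ and $(0,1)$, the cross ratio $[A^{i,j},B^{i,j},C^{i,j},D^{i,j}]$ of the four lines in the two-dimensional space $\mathbb{C}^3/(A_i\oplus C_j)$ given by the images of $A_{i+1}\oplus C_j$, $B_1\oplus A_i\oplus C_j$, $A_i\oplus C_{j+1}$, $D_1\oplus A_i\oplus C_j$. Triple ratio. For flags $A,B,C$ in generic position in $\mathbb{C}^3$ with $v_a,v_b,v_c$ spanning $A_1,B_1,C_1$ and linear forms $f_a,f_b,f_c\in(\mathbb{C}^3)^*$ with kernels $A_2,B_2,C_2$, $$r_3(A,B,C)=\frac{f_a(v_b)\,f_b(v_c)\,f_c(v_a)}{f_a(v_c)\,f_b(v_a)\,f_c(v_b)}.$$ *)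

(* Defs.v *)
From HB Require Import structures.
From mathcomp Require Import all_boot all_order all_algebra.
From mathcomp Require Import generic_quotient complex ring.
From mathcomp Require Import boolp classical_sets reals.

Set Implicit Arguments.
Unset Strict Implicit.
Unset Printing Implicit Defensive.

Import Order.TTheory GRing.Theory Num.Theory.

Local Open Scope ring_scope.
Local Open Scope quotient_scope.
Local Open Scope complex_scope.

Definition GL (F : fieldType) (n : nat) := {A : 'M[F]_n | A \in unitmx}.

HB.instance Definition _ F n := Choice.on (GL F n).

Section LinearGroup.
Variables (F : fieldType) (n : nat).
Implicit Types A B C : GL F n.

Lemma gl_one_proof : 1%:M \in (unitmx : {pred 'M[F]_n}).
Proof. exact: unitmx1. Qed.

Lemma gl_mul_proof A B : val A *m val B \in unitmx.
Proof. by rewrite unitmx_mul (valP A) (valP B). Qed.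

Lemma gl_inv_proof A : invmx (val A) \in unitmx.
Proof. by rewrite unitmx_inv (valP A). Qed.

Definition gl_one : GL F n := exist (fun A : 'M_n => A \in unitmx) _ gl_one_proof.
Definition gl_mul A B : GL F n := exist (fun A : 'M_n => A \in unitmx) _ (gl_mul_proof A B).
Definition gl_inv A : GL F n := exist (fun A : 'M_n => A \in unitmx) _ (gl_inv_proof A).

Lemma gl_mulA : associative gl_mul.
Proof. by move=> A B C; apply: val_inj; rewrite /= mulmxA. Qed.
Lemma gl_mul1 : left_id gl_one gl_mul.
Proof. by move=> A; apply: val_inj; rewrite /= mul1mx. Qed.
Lemma gl_mulr1 : right_id gl_one gl_mul.
Proof. by move=> A; apply: val_inj; rewrite /= mulmx1. Qed.
Lemma gl_mulV : left_inverse gl_one gl_inv gl_mul.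
Proof. by move=> A; apply: val_inj; rewrite /= mulVmx ?(valP A). Qed.
Lemma gl_mulrV : right_inverse gl_one gl_inv gl_mul.
Proof. by move=> A; apply: val_inj; rewrite /= mulmxV ?(valP A). Qed.

HB.instance Definition _ :=
  isGroup.Build (GL F n) gl_mulA gl_mul1 gl_mulr1 gl_mulV gl_mulrV.

Definition proportional A B : bool :=
  `[< exists2 c : F, c != 0 & val A = c *: val B >].

Lemma proportional_refl : reflexive proportional.
Proof. by move=> A; apply/asboolP; exists 1; rewrite ?oner_eq0 ?scale1r. Qed.

Lemma proportional_trans : transitive proportional.
Proof.
move=> B A C /asboolP[c c0 eA] /asboolP[d d0 eB]; apply/asboolP.
by exists (c * d); rewrite ?mulf_neq0 // eA eB scalerA.
Qed.

Lemma proportional_sym : symmetric proportional.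
Proof.
suff h A B : proportional A B -> proportional B A.
  by move=> A B; apply/idP/idP; apply: h.
move=> /asboolP[c c0 eA]; apply/asboolP; exists c^-1; first by rewrite invr_eq0.
by rewrite eA scalerA mulVf ?scale1r.
Qed.

Canonical proportional_equiv :=
  EquivRel proportional proportional_refl proportional_sym proportional_trans.

Definition PGL := {eq_quot proportional}.

HB.instance Definition _ := Choice.on PGL.
HB.instance Definition _ := EqQuotient.on PGL.

Definition pgl_one : PGL := lift_cst PGL 1%g.
Definition pgl_mul := lift_op2 PGL (fun A B => A * B)%g.
Definition pgl_inv := lift_op1 PGL (fun A => A^-1)%g.

Canonical pi_pgl_one_const := PiConst pgl_one.

Lemma pi_pgl_mul : {morph \pi_PGL : A B / (A * B)%g >-> pgl_mul A B}.
Proof.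
move=> A B; unlock pgl_mul; apply/eqmodP/asboolP => /=.
case: piP => A' /eqmodP/asboolP[c c0 eA]; case: piP => B' /eqmodP/asboolP[d d0 eB].
exists (c * d); first by rewrite mulf_neq0.
by rewrite [LHS]/= eA eB -scalemxAl -scalemxAr scalerA.
Qed.
Canonical pi_pgl_mul_morph := PiMorph2 pi_pgl_mul.

Lemma pi_pgl_inv : {morph \pi_PGL : A / (A^-1)%g >-> pgl_inv A}.
Proof.
move=> A; unlock pgl_inv; apply/eqmodP/asboolP => /=.
case: piP => A' /eqmodP/asboolP[c c0 eA].
exists c^-1; first by rewrite invr_eq0.
by rewrite [LHS]/= eA invmxZ // -eA (valP A).
Qed.
Canonical pi_pgl_inv_morph := PiMorph1 pi_pgl_inv.

Lemma pgl_mulA : associative pgl_mul.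
Proof.
by move=> x y z; rewrite -[x]reprK -[y]reprK -[z]reprK !piE mulgA.
Qed.
Lemma pgl_mul1 : left_id pgl_one pgl_mul.
Proof. by move=> x; rewrite -[x]reprK !piE mul1g. Qed.
Lemma pgl_mulr1 : right_id pgl_one pgl_mul.
Proof. by move=> x; rewrite -[x]reprK !piE mulg1. Qed.
Lemma pgl_mulV : left_inverse pgl_one pgl_inv pgl_mul.
Proof. by move=> x; rewrite -[x]reprK !piE mulVg. Qed.
Lemma pgl_mulrV : right_inverse pgl_one pgl_inv pgl_mul.
Proof. by move=> x; rewrite -[x]reprK !piE mulgV. Qed.

HB.instance Definition _ :=
  isGroup.Build PGL pgl_mulA pgl_mul1 pgl_mulr1 pgl_mulV pgl_mulrV.

End LinearGroup.

(* A representative, determined up to a nonzero scalar; everything defined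
   through it below is invariant under rescaling, except that the eigenvalues
   are rescaled simultaneously. *)
Definition mx_of (F : fieldType) (n : nat) (M : PGL F n) : 'M[F]_n :=
  val (repr M).

Lemma gl_complex_proof (R : rcfType) (n : nat) (A : GL R n) :
  map_mx (real_complex R) (val A) \in unitmx.
Proof. by rewrite map_unitmx (valP A). Qed.

Definition gl_complex (R : rcfType) (n : nat) (A : GL R n) : GL R[i] n :=
  exist (fun B : 'M_n => B \in unitmx) _ (gl_complex_proof A).

Definition in_PGL_real (R : rcfType) (n : nat) (M : PGL R[i] n) : Prop :=
  exists A : GL R n, M = \pi_(PGL R[i] n) (gl_complex A).

Section EigenvalueTypes.
Variable R : realType.
Local Notation C := R[i].
Implicit Types (u z w : C) (M : PGL C 3).

(* A nonzero u stands for the real line through 0 and u. *)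
Definition on_line u z : Prop := exists t : R, z = t%:C * u.
Definition reflection u z : C := u / (u^*)%R * (z^*)%R.

Definition eig M z : Prop := eigenvalue (mx_of M) z.

Definition compatible_line M u : Prop :=
  u != 0 /\
  forall z, eig M z ->
    on_line u z \/ exists w, [/\ eig M w, w != z & reflection u z = w].

Definition hyperbolic M : Prop :=
  exists2 u, u != 0 & forall z, eig M z -> on_line u z.

(* z1 and z3 are swapped by the reflection about a line containing z2. *)
Definition elliptic_pair z1 z3 z2 : Prop :=
  exists u, [/\ u != 0, reflection u z1 = z3 & on_line u z2].

Definition elliptic M : Prop :=
  exists z1 z2 z3, [/\ uniq [:: z1; z2; z3], eig M z1, eig M z2, eig M z3
                     & elliptic_pair z1 z3 z2].

(* In the second clause the line containing z and w and the line of the reflection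
   need not be the same; in the third, u and v range over all lines for which the
   eigenvalues are compatible, and the labelling is membership in the line. *)
Definition generic_eigenvalues M : Prop :=
  [/\ forall z, (mup z (char_poly (mx_of M)) <= 1)%N,
      forall z w, eig M z -> eig M w -> z != w ->
        ~ ((exists u, [/\ u != 0, on_line u z & on_line u w]) /\
           (exists u, u != 0 /\ reflection u z = w))
    & forall u v, compatible_line M u -> compatible_line M v ->
        forall z, eig M z -> (on_line u z <-> on_line v z)].

End EigenvalueTypes.

Record flag (F : fieldType) := Flag {
  flag1 : {vspace 'cV[F]_3};
  flag2 : {vspace 'cV[F]_3};
  dim_flag1 : \dim flag1 = 1%N;
  dim_flag2 : \dim flag2 = 2%N;
  flag12 : (flag1 <= flag2)%VS }.

Definition flag_space (F : fieldType) (A : flag F) (i : nat) :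
    {vspace 'cV[F]_3} :=
  match i with 0 => 0%VS | 1 => flag1 A | 2 => flag2 A | _ => fullv end.

Coercion flag_space : flag >-> Funclass.

Definition generic_position (F : fieldType) (k : nat) (Fs : k.-tuple (flag F)) :
    Prop :=
  forall d : 'I_k -> nat, (\sum_j d j)%N = 3 ->
    directv (\sum_j tnth Fs j (d j)) /\ (\sum_j tnth Fs j (d j))%VS = fullv.

(* Matrices act on the left on the columns of 'cV_3. The library predicate
   eigenvalue used in eig is phrased with row vectors, but singles out the same
   scalars. *)
Definition eigenvector (F : fieldType) (M : PGL F 3) (z : F) (v : 'cV[F]_3) :
    Prop :=
  v != 0 /\ mx_of M *m v = z *: v.

(* For elliptic M, m1 and m3 form the elliptic pair; otherwise the order is
   arbitrary. *)
Definition eigenflag_pair (R : realType) (M : PGL R[i] 3) (b b' : flag R[i]) :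
    Prop :=
  exists (z1 z2 z3 : R[i]) (m1 m2 m3 : 'cV[R[i]]_3),
    [/\ uniq [:: z1; z2; z3],
        [/\ eigenvector M z1 m1, eigenvector M z2 m2 & eigenvector M z3 m3],
        elliptic M -> elliptic_pair z1 z3 z2,
        b 1 = <[m1]>%VS /\ b 2 = (<[m1]> + <[m2]>)%VS
      & b' 1 = <[m3]>%VS /\ b' 2 = (<[m3]> + <[m2]>)%VS].

Section Ratios.
Variable F : fieldType.
Implicit Types A B C D : flag F.

Definition det2 (x y : 'cV[F]_2) : F := x 0 0 * y 1 0 - x 1 0 * y 0 0.

(* The affine point a of the projective line is the line spanned by (a, 1), and
   infinity is the line spanned by (1, 0); see cross_ratio_affine. *)
Definition cross_ratio (a b c d : {vspace 'cV[F]_2}) : F :=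
  (det2 (vpick a) (vpick d) * det2 (vpick c) (vpick b)) /
  (det2 (vpick a) (vpick b) * det2 (vpick c) (vpick d)).

(* A linear map onto F^2 with kernel L, i.e., a choice of coordinates on the
   two-dimensional quotient F^3 / L; cross ratios do not depend on it. *)
Definition quotient_map (L : {vspace 'cV[F]_3}) : 'Hom('cV[F]_3, 'cV[F]_2) :=
  xget 0 [set q : 'Hom('cV[F]_3, 'cV[F]_2) | lker q = L].

Definition flag_cross_ratio (i j : nat) A B C D : F :=
  let q := quotient_map (A i + C j) in
  cross_ratio (q @: (A i.+1 + C j)) (q @: (B 1 + A i + C j))
              (q @: (A i + C j.+1)) (q @: (D 1 + A i + C j)).

Definition kernel_form (P : {vspace 'cV[F]_3}) : 'Hom('cV[F]_3, F^o) :=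
  xget 0 [set f : 'Hom('cV[F]_3, F^o) | lker f = P].

Definition triple_ratio A B C : F :=
  let va := vpick (A 1) in let vb := vpick (B 1) in let vc := vpick (C 1) in
  let fa := kernel_form (A 2) in
  let fb := kernel_form (B 2) in
  let fc := kernel_form (C 2) in
  (fa vb * fb vc * fc va) / (fa vc * fb va * fc vb).

End Ratios.

Section CrossRatioFormula.
Variable F : fieldType.
Implicit Types x y z t : 'cV[F]_2.

Lemma cross_ratio_line x y z t :
    x != 0 -> y != 0 -> z != 0 -> t != 0 ->
  cross_ratio <[x]> <[y]> <[z]> <[t]> =
    (det2 x t * det2 z y) / (det2 x y * det2 z t).
Proof.
have pick v : v != 0 -> exists2 k : F, k != 0 & vpick <[v]>%VS = k *: v.
  move=> v0; have /vlineP[k ek] := memv_pick <[v]>%VS; exists k => //.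
  apply: contraNneq v0 => k0; have := vpick0 <[v]>%VS.
  by rewrite ek k0 scale0r eqxx => /esym; rewrite -subv0 -memvE memv0.
move=> /pick[a a0 ea] /pick[b b0 eb] /pick[c c0 ec] /pick[d d0 ed].
have detZ k l (u v : 'cV[F]_2) : det2 (k *: u) (l *: v) = k * l * det2 u v.
  by rewrite /det2 !mxE mulrBr !mulrA !(mulrAC k _ l).
rewrite /cross_ratio ea eb ec ed !detZ.
have -> : a * d * det2 x t * (c * b * det2 z y) =
          a * b * c * d * (det2 x t * det2 z y) by ring.
have -> : a * b * det2 x y * (c * d * det2 z t) =
          a * b * c * d * (det2 x y * det2 z t) by ring.
by rewrite -mulf_div divff ?mul1r // !mulf_neq0.
Qed.

Definition affine_pt (a : F) : 'cV[F]_2 := \col_i (if i == 0 then a else 1).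

Lemma cross_ratio_affine (a b c d : F) :
  cross_ratio <[affine_pt a]> <[affine_pt b]> <[affine_pt c]> <[affine_pt d]> =
    ((a - d) * (c - b)) / ((a - b) * (c - d)).
Proof.
have nz e : affine_pt e != 0.
  apply/eqP => /matrixP/(_ 1 0); rewrite !mxE /= => /eqP.
  by rewrite oner_eq0.
by rewrite cross_ratio_line ?nz // /det2 !mxE /= !mulr1 !mul1r.
Qed.

End CrossRatioFormula.

(* Main.v *)
From HB Require Import structures.
Require Import Defs.
From mathcomp Require Import all_boot all_order all_algebra.
From mathcomp Require Import generic_quotient complex reals boolp classical_sets ring.

Import GRing.Theory Num.Theory.
Local Open Scope ring_scope.

(* Conjugating by G into PGL_3(R) amounts to choosing the antilinear involution
   s = G o conj o G^-1. By genericity of the eigenvalues, G^-1 M G is real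
   exactly when s fixes both eigendirection flags of a hyperbolic M, and
   exchanges those of an elliptic M. The cross ratios and triple ratios are
   quotients of 3 x 3 determinants, hence s conjugates them, which gives the
   necessity of (a)-(g). Conversely, choose a basis a, e, c with a in A_1,
   e in A_2 /\ C_2, c in C_1 and a + e + c in D_1, and let s be coordinatewise
   conjugation. It fixes A, C and D_1, and since the invariants of a flag
   relative to A, C and D determine that flag, (a)-(g) force s to act on all the
   eigendirection flags as required. *)

(** * Determinants of three column vectors *)

Section Det3.
Set Implicit Arguments.
Unset Strict Implicit.
Variable F : fieldType.
Implicit Types a b c d v w x : 'cV[F]_3.

Definition mx3 a b c : 'M[F]_3 :=
  \matrix_(i, j) (if j == 0 then a i 0 else if j == 1 then b i 0 else c i 0).

(** For independent [a] and [b], [det3 a b] is a linear form whose kernel is their plane; flags and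
    their ratios are computed through such forms. *)
Definition det3 a b c : F := \det (mx3 a b c).

Lemma ord3E (P : 'I_3 -> Prop) : P 0 -> P 1 -> P (2%:R) -> forall i, P i.
Proof.
move=> p0 p1 p2 [[|[|[|//]]] h].
- by have <- : 0 = Ordinal h by apply: val_inj.
- by have <- : 1 = Ordinal h by apply: val_inj.
- by have <- : 2%:R = Ordinal h by apply: val_inj.
Qed.

Lemma det3E a b c : det3 a b c =
  a 0 0 * (b 1 0 * c 2%:R 0 - b 2%:R 0 * c 1 0)
  - a 1 0 * (b 0 0 * c 2%:R 0 - b 2%:R 0 * c 0 0)
  + a 2%:R 0 * (b 0 0 * c 1 0 - b 1 0 * c 0 0).
Proof.
(* Reading entries at natural-number indices identifies the various ordinal terms that the expansion
   produces, so that [ring] sees nine atoms. *)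
pose f (v : 'cV[F]_3) n := v (inord n) 0.
have fE v (i : 'I_3) : v i 0 = f v i by rewrite /f inord_val.
rewrite /det3 (expand_det_col _ 0) !big_ord_recl big_ord0.
rewrite /cofactor !(expand_det_row _ 0) !big_ord_recl !big_ord0.
rewrite /cofactor !det_mx11 !mxE /= !fE /= /bump /= !addn0 ?addn1 ?add0n ?add1n /=.
ring.
Qed.

Lemma det3_lin a b k c l d :
  det3 a b (k *: c + l *: d) = k * det3 a b c + l * det3 a b d.
Proof. by rewrite !det3E !mxE; ring. Qed.

Lemma det3_rot a b c : det3 b c a = det3 a b c.
Proof. by rewrite !det3E; ring. Qed.

Lemma det3_swap a b c : det3 b a c = - det3 a b c.
Proof. by rewrite !det3E; ring. Qed.

Lemma det3_eq0 a b : (det3 a a b = 0) * (det3 a b b = 0) * (det3 a b a = 0).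
Proof. by rewrite !det3E; split; [split|]; ring. Qed.

Lemma det3Zl k a b c : det3 (k *: a) b c = k * det3 a b c.
Proof. by rewrite !det3E !mxE; ring. Qed.

Lemma det3Zm k a b c : det3 a (k *: b) c = k * det3 a b c.
Proof. by rewrite !det3E !mxE; ring. Qed.

Lemma det3Zr k a b c : det3 a b (k *: c) = k * det3 a b c.
Proof. by rewrite !det3E !mxE; ring. Qed.

Lemma cramer3 a b c v : det3 a b c *: v =
  det3 v b c *: a + det3 a v c *: b + det3 a b v *: c.
Proof.
apply/matrixP => i j; rewrite (ord1 j) {j}; move: i; apply: ord3E;
by rewrite !mxE !det3E; ring.
Qed.

Lemma cramer3V a b c v : det3 a b c != 0 ->
  v = (det3 v b c / det3 a b c) *: a + (det3 a v c / det3 a b c) *: b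
      + (det3 a b v / det3 a b c) *: c.
Proof.
move=> d0; have vE : v = (det3 a b c)^-1 *: (det3 a b c *: v)
  by rewrite scalerA mulVf ?scale1r.
by rewrite {1}vE cramer3 !scalerDr !scalerA ![_^-1 * _]mulrC.
Qed.

Lemma det3_span a b c v : det3 a b c != 0 ->
  exists k l m, v = k *: a + l *: b + m *: c.
Proof. by move/(cramer3V v)=> ->; do 3!eexists. Qed.

Lemma mulmx_mx3 (M : 'M_3) a b c : M *m mx3 a b c = mx3 (M *m a) (M *m b) (M *m c).
Proof.
apply/matrixP => i j; rewrite !mxE; move: j; apply: ord3E => /=.
all: by rewrite ?mxE; apply: eq_bigr => k _; rewrite !mxE.
Qed.

Lemma det3_mulmx (M : 'M_3) a b c :
  det3 (M *m a) (M *m b) (M *m c) = \det M * det3 a b c.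
Proof. by rewrite /det3 -mulmx_mx3 det_mulmx. Qed.

Lemma memv_line2 a b v :
  reflect (exists k l, v = k *: a + l *: b) (v \in (<[a]> + <[b]>)%VS).
Proof.
apply: (iffP memv_addP) => [[_ /vlineP[k ->] [_ /vlineP[l ->] ->]]|[k [l ->]]].
  by exists k, l.
by exists (k *: a); rewrite ?memvZ ?memv_line //; exists (l *: b); rewrite ?memvZ ?memv_line.
Qed.

(** If the determinant were zero, a nonzero row vector [w] would annihilate [a], [b], [c], hence
    their span, which is the whole space. *)
Lemma span_full_det3 a b c :
  (<[a]> + <[b]> + <[c]>)%VS = fullv -> det3 a b c != 0.
Proof.
move=> ful; apply/negP => /det0P[w w0 /rowP wE].
have w3 : (w *m a = 0) * (w *m b = 0) * (w *m c = 0).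
  split; [split|]; apply/matrixP => i j; rewrite !ord1 {i j}.
  - by have := wE 0; rewrite !mxE => e; rewrite -[RHS]e;
    apply: eq_bigr => k _; rewrite !mxE.
  - by have := wE 1; rewrite !mxE => e; rewrite -[RHS]e;
    apply: eq_bigr => k _; rewrite !mxE.
  - by have := wE 2%:R; rewrite !mxE => e; rewrite -[RHS]e;
    apply: eq_bigr => k _; rewrite !mxE.
have wv (v : 'cV[F]_3) : w *m v = 0.
  have : v \in (<[a]> + <[b]> + <[c]>)%VS by rewrite ful memvf.
  case/memv_addP => u /memv_line2[k [l ->]] [_ /vlineP[m ->] ->].
  by rewrite !mulmxDr -!scalemxAr !w3 !scaler0 !addr0.
case/eqP: w0; apply/rowP => i; have /matrixP/(_ 0 0) := wv (delta_mx i 0).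
by rewrite -colE !mxE.
Qed.

(** Applying the form [det3 x y], with [x] and [y] two of the three vectors, isolates the
    coefficient of the third. *)
Lemma det3_neq0_basis a b c k l m : det3 a b c != 0 ->
  k *: a + l *: b + m *: c = 0 -> [/\ k = 0, l = 0 & m = 0].
Proof.
move=> d0 e.
have e' : m *: c = (- k) *: a + (- l) *: b.
  by apply/eqP; rewrite !scaleNr -opprD -addr_eq0 addrC e.
have E x y : det3 x y (k *: a + l *: b + m *: c) =
    k * det3 x y a + l * det3 x y b + m * det3 x y c.
  by rewrite -[k *: a + _]scale1r det3_lin mul1r det3_lin.
have z x y : k * det3 x y a + l * det3 x y b + m * det3 x y c = 0.
  by rewrite -E e !det3E !mxE; ring.
have bc : det3 b c a = det3 a b c by rewrite det3_rot.
have ca : det3 c a b = det3 a b c by rewrite -det3_rot.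
split; apply: (mulIf d0); rewrite mul0r.
- by rewrite -[RHS](z b c) !det3_eq0 bc !mulr0 !addr0.
- by rewrite -[RHS](z c a) !det3_eq0 ca !mulr0 add0r addr0.
- by rewrite -[RHS](z a b) !det3_eq0 !mulr0 !add0r.
Qed.

End Det3.

(** * Adapted bases of flags, and the ratios as quotients of determinants *)

Section Frames.
Set Implicit Arguments.
Unset Strict Implicit.
Variable F : fieldType.
Implicit Types (A B C D : flag F) (a b c d v w x : 'cV[F]_3).

Definition frame A a1 a2 : Prop :=
  A 1 = <[a1]>%VS /\ A 2 = (<[a1]> + <[a2]>)%VS.

Lemma dim_cV3 : \dim {:'cV[F]_3} = 3.
Proof. by rewrite dimvf /dim /= muln1. Qed.

Lemma span1P (U : {vspace 'cV[F]_3}) v :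
  \dim U = 1%N -> v \in U -> v != 0 -> U = <[v]>%VS.
Proof.
by move=> dU vU v0; apply/eqP; rewrite eq_sym eqEdim -memvE vU dU dim_vline v0.
Qed.

Lemma dim_add_line (U : {vspace 'cV[F]_3}) v :
  v \notin U -> \dim (U + <[v]>)%VS = (\dim U).+1.
Proof.
move=> vU; have v0 : v != 0 by apply: contraNneq vU => ->; rewrite mem0v.
rewrite dimv_disjoint_sum ?dim_vline ?v0 ?addn1 //.
apply/eqP; rewrite -subv0; apply/subvP => x /memv_capP[xU /vlineP[k e]].
by rewrite memv0; move: xU; rewrite e rpredZeq (negbTE vU) orbF => /eqP->; rewrite scale0r.
Qed.

Lemma span2P (U : {vspace 'cV[F]_3}) v w :
  \dim U = 2%N -> v \in U -> v != 0 -> w \in U -> w \notin <[v]>%VS ->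
  U = (<[v]> + <[w]>)%VS.
Proof.
move=> dU vU v0 wU wv; apply/eqP.
rewrite eq_sym eqEdim subv_add -!memvE vU wU dU dim_add_line //.
by rewrite dim_vline v0.
Qed.

Lemma frameP A a1 a2 : a1 \in A 1 -> a1 != 0 -> a2 \in A 2 -> a2 \notin A 1 ->
  frame A a1 a2.
Proof.
move=> h1 n1 h2 n2; have e1 := span1P (dim_flag1 A) h1 n1.
split=> //; apply: span2P n1 h2 _; rewrite ?(dim_flag2 A) // -?e1 //.
exact: subvP (flag12 A) _ h1.
Qed.

Lemma exists_frame A : exists a1 a2, frame A a1 a2.
Proof.
have n1 : vpick (A 1) != 0.
  by rewrite vpick0; apply/negP => /eqP e; have := dim_flag1 A; rewrite [flag1 A]e dimv0.
have : ~~ (A 2 <= A 1)%VS.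
  by apply/negP => /dimvS /=; rewrite (dim_flag1 A) (dim_flag2 A).
case/subvPn => x x2 x1; exists (vpick (A 1)), x.
by apply: frameP => //; apply: memv_pick.
Qed.

Lemma frame_mem A a1 a2 : frame A a1 a2 -> [/\ a1 \in A 1, a1 \in A 2 & a2 \in A 2].
Proof.
move=> [e1 e2]; rewrite e1 e2 memv_line.
by split=> //; apply/memv_line2; [exists 1, 0|exists 0, 1];
   rewrite ?scale1r ?scale0r ?addr0 ?add0r.
Qed.

Lemma frame_neq0 A a1 a2 : frame A a1 a2 -> a1 != 0.
Proof.
move=> [e1 _]; apply/eqP => a0; have := dim_flag1 A.
by rewrite [flag1 A]e1 a0 dim_vline eqxx.
Qed.

Lemma frame_notin A a1 a2 : frame A a1 a2 -> a2 \notin A 1.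
Proof.
move=> fA; have [e1 e2] := fA; rewrite e1; apply/negP => a21.
have := dim_flag2 A; rewrite [flag2 A]e2 (addv_idPl _) ?dim_vline ?(frame_neq0 fA) //.
Qed.

(** The form [det3 a1 a2] is an equation of the plane: by dimension, a vector outside [A 2]
    completes it to the whole space, so the determinant is nonzero. *)
Lemma mem_flag2 A a1 a2 v : frame A a1 a2 -> (v \in A 2) = (det3 a1 a2 v == 0).
Proof.
move=> [e1 e2]; apply/idP/idP.
  rewrite e2 => /memv_line2[k [l ->]].
  by rewrite det3_lin !det3_eq0 !mulr0 addr0.
apply: contraTT => vA; apply: span_full_det3; rewrite -e2.
apply/eqP; rewrite eqEdim subvf dim_cV3 dim_add_line //.
by rewrite (dim_flag2 A).
Qed.

Lemma frame_compl A a1 a2 : frame A a1 a2 -> exists w, det3 a1 a2 w != 0.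
Proof.
move=> fA; have : ~~ ({:'cV[F]_3} <= A 2)%VS.
  by apply/negP => /dimvS; rewrite dim_cV3 (dim_flag2 A).
by case/subvPn => w _; rewrite (mem_flag2 _ fA); exists w.
Qed.

(** Linear forms with the same kernel are proportional, so the arbitrary choice made by
    [kernel_form] can be traded for a determinant. *)
Lemma kernel_formE A a1 a2 : frame A a1 a2 ->
  exists2 k, k != 0 & forall v, kernel_form (A 2) v = k * det3 a1 a2 v.
Proof.
move=> fA; have [w w0] := frame_compl fA.
have kerE : lker (kernel_form (A 2)) = A 2.
  (* The default [0] of [xget] does not occur: [det3 a1 a2] is a form with the required kernel. *)
  rewrite /kernel_form; case: xgetP => [f _ //|none].
  have lin : linear (fun v => det3 a1 a2 v : F^o).
    by move=> k u v; rewrite -[v in LHS]scale1r det3_lin mul1r.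
  pose L := GRing.isLinear.Build _ _ _ _ _ lin.
  pose f : {linear 'cV[F]_3 -> F^o} := HB.pack (fun v => det3 a1 a2 v : F^o) L.
  case: (none (linfun f)) => /=.
  by apply/vspaceP => v; rewrite memv_ker (lfunE f) (mem_flag2 _ fA).
set f := kernel_form _ in kerE *.
exists (f w / det3 a1 a2 w).
  rewrite mulf_neq0 ?invr_eq0 //; apply/negP => /eqP fw.
  have : w \in lker f by rewrite memv_ker fw.
  by rewrite kerE (mem_flag2 _ fA) (negbTE w0).
move=> v; have [_ m1 m2] := frame_mem fA.
have [f1 f2] : f a1 = 0 /\ f a2 = 0 by split; apply/eqP; rewrite -memv_ker kerE.
rewrite {1}(cramer3V v w0) !linearD !linearZ /= f1 f2 !scaler0 !add0r.
by rewrite -[LHS]/(det3 a1 a2 v / det3 a1 a2 w * f w) mulrC mulrA mulrAC.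
Qed.

Lemma vpick_line v : exists2 k, (v != 0 -> k != 0) & vpick <[v]>%VS = k *: v.
Proof.
have /vlineP[k ek] := memv_pick <[v]>%VS; exists k => // v0.
apply: contraNneq v0 => k0; have := vpick0 <[v]>%VS.
by rewrite ek k0 scale0r eqxx => /esym; rewrite -subv0 -memvE memv0.
Qed.

(** Each of the three forms and three vectors occurs once in the numerator and once in the
    denominator, so the unknown scalars cancel. *)
Lemma triple_ratioE A B C a1 a2 b1 b2 c1 c2 :
  frame A a1 a2 -> frame B b1 b2 -> frame C c1 c2 ->
  triple_ratio A B C =
    (det3 a1 a2 b1 * det3 b1 b2 c1 * det3 c1 c2 a1) /
    (det3 a1 a2 c1 * det3 b1 b2 a1 * det3 c1 c2 b1).
Proof.
move=> fA fB fC; rewrite /triple_ratio.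
have [ka ka0 aE] := kernel_formE fA.
have [kb kb0 bE] := kernel_formE fB.
have [kc kc0 cE] := kernel_formE fC.
rewrite !aE !bE !cE (proj1 fA) (proj1 fB) (proj1 fC).
have [la la0 ->] := vpick_line a1; have [lb lb0 ->] := vpick_line b1.
have [lc lc0 ->] := vpick_line c1; rewrite !det3Zr.
move: la0 lb0 lc0 => /(_ (frame_neq0 fA)) la0.
move=> /(_ (frame_neq0 fB)) lb0 /(_ (frame_neq0 fC)) lc0.
set x := det3 a1 a2 b1; set y := det3 b1 b2 c1; set z := det3 c1 c2 a1.
set s := det3 a1 a2 c1; set t := det3 b1 b2 a1; set u := det3 c1 c2 b1.
pose m := ka * kb * kc * la * lb * lc.
have m0 : m != 0 by rewrite !mulf_neq0.
transitivity ((m * (x * y * z)) / (m * (s * t * u))).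
  by congr (_ / _); rewrite /m; ring.
by rewrite -mulf_div divff // mul1r.
Qed.

(** * Cross ratios in the quotient by a line *)

Lemma quotient_mapE a b c : det3 a b c != 0 ->
  lker (quotient_map <[a]>) = <[a]>%VS.
Proof.
move=> d0; rewrite /quotient_map; case: xgetP => [f _ //|none].
(* Up to the factor [det3 a b c], these are the coordinates of [v] along [c] and [b], so exactly the
   multiples of [a] are killed. *)
pose g v : 'cV[F]_2 := \col_i (if i == 0 then det3 a b v else det3 c a v).
have lin : linear g.
  move=> k u v; apply/colP => i; rewrite !mxE.
  by case: ifP => _; rewrite -[v in LHS]scale1r det3_lin mul1r.
pose L := GRing.isLinear.Build _ _ _ _ _ lin.
pose f : {linear 'cV[F]_3 -> 'cV[F]_2} := HB.pack g L.
case: (none (linfun f)) => /=; apply/vspaceP => v.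
rewrite memv_ker (lfunE f) /=; apply/eqP/vlineP => [/colP e|[k ->]].
  have := e 0; have := e 1; rewrite !mxE /= => e1 e2.
  rewrite (cramer3V v d0) e2 (det3_rot c a v) e1 !mul0r !scale0r !addr0.
  by exists (det3 v b c / det3 a b c).
by apply/colP => i; rewrite !mxE !det3Zr !det3_eq0 mulr0; case: ifP.
Qed.

Lemma det2_lin (x y : 'cV[F]_2) k l m n :
  det2 (k *: x + l *: y) (m *: x + n *: y) = (k * n - l * m) * det2 x y.
Proof. by rewrite /det2 !mxE; ring. Qed.

(** Both sides are alternating bilinear forms on the two-dimensional quotient by [a], hence
    proportional; the factor is read off at [b], [c]. *)
Lemma det2_quotient_map a b c : det3 a b c != 0 ->
  exists2 k, k != 0 &
    forall v w, det2 (quotient_map <[a]> v) (quotient_map <[a]> w) = k * det3 a v w.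
Proof.
move=> d0; have kerE := quotient_mapE d0.
set q := quotient_map _ in kerE *.
have q0 k l : k *: q b + l *: q c = 0 -> k = 0 /\ l = 0.
  move=> e; have : k *: b + l *: c \in lker q by rewrite memv_ker linearD !linearZ /= e.
  rewrite kerE => /vlineP[m em]; have : (- m) *: a + k *: b + l *: c = 0.
    by rewrite -addrA em scaleNr addNr.
  by case/(det3_neq0_basis d0).
exists (det2 (q b) (q c) / det3 a b c).
  rewrite mulf_neq0 ?invr_eq0 //; apply/negP => /eqP e.
  (* If the determinant of [q b] and [q c] vanished, each row of their coordinates would give a
     linear relation between them; so all coordinates would be zero, against independence. *)
  have [y0 x0] : q c 0 0 = 0 /\ - q b 0 0 = 0.
    apply: q0; apply/colP; case=> [[|[|//]] h]; rewrite !mxE.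
      by have -> : Ordinal h = 0 by [apply: val_inj]; ring.
    have -> : Ordinal h = 1 by apply: val_inj.
    by rewrite -[RHS]oppr0 -e /det2; ring.
  have [y1 x1] : q c 1 0 = 0 /\ - q b 1 0 = 0.
    apply: q0; apply/colP; case=> [[|[|//]] h]; rewrite !mxE.
      have -> : Ordinal h = 0 by apply: val_inj.
      by rewrite -[RHS]e /det2; ring.
    by have -> : Ordinal h = 1 by [apply: val_inj]; ring.
  have [] : 1 = 0 :> F /\ 0 = 0 :> F.
    apply: q0; rewrite scale0r addr0 scale1r; apply/colP.
    case=> [[|[|//]] h]; rewrite mxE.
      have -> : Ordinal h = 0 by apply: val_inj.
      by rewrite -[LHS]opprK x0 oppr0.
    have -> : Ordinal h = 1 by apply: val_inj.
    by rewrite -[LHS]opprK x1 oppr0.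
  by move/eqP; rewrite oner_eq0.
have qa : q a = 0 by apply/eqP; rewrite -memv_ker kerE memv_line.
move=> v w.
have E u : q u = (det3 a u c / det3 a b c) *: q b + (det3 a b u / det3 a b c) *: q c.
  by rewrite {1}(cramer3V u d0) !linearD !linearZ /= qa scaler0 add0r.
rewrite (E v) (E w) det2_lin.
(* A quadratic relation among determinants, obtained by expanding [w] with Cramer's rule. *)
have -> : det3 a v w = (det3 a v c * det3 a b w - det3 a b v * det3 a w c) / det3 a b c.
  apply: (mulfI d0); rewrite [RHS]mulrC mulfVK // -[LHS]det3Zr cramer3.
  rewrite -[_ *: a + _]scale1r det3_lin mul1r det3_lin !det3_eq0 (det3_rot b a v).
  by rewrite (det3_swap a b v); ring.
by field.
Qed.

(** Every vector occurs in the numerator, so a zero vector makes both sides zero. The determinant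
    formulas for cross ratios thus hold for all framed flags, without side conditions. *)
Lemma cross_ratio_line0 (x y z t : 'cV[F]_2) :
  cross_ratio <[x]> <[y]> <[z]> <[t]> =
    (det2 x t * det2 z y) / (det2 x y * det2 z t).
Proof.
have d0 (v : 'cV[F]_2) : (det2 0 v = 0) * (det2 v 0 = 0).
  by rewrite /det2 !mxE; split; ring.
have p0 : vpick <[0 : 'cV[F]_2]>%VS = 0.
  by have /vlineP[k ->] := memv_pick <[0 : 'cV[F]_2]>%VS; rewrite scaler0.
have [->|x0] := eqVneq x 0; first by rewrite /cross_ratio p0 !d0 !mul0r.
have [->|y0] := eqVneq y 0; first by rewrite /cross_ratio p0 !d0 !(mulr0, mul0r).
have [->|z0] := eqVneq z 0; first by rewrite /cross_ratio p0 !d0 !(mulr0, mul0r).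
have [->|t0] := eqVneq t 0; first by rewrite /cross_ratio p0 !d0 !(mulr0, mul0r).
exact: cross_ratio_line.
Qed.

Lemma cross_ratio_quotient a b c x y z t : det3 a b c != 0 ->
  let q := quotient_map <[a]> in
  cross_ratio (q @: <[x]>) (q @: <[y]>) (q @: <[z]>) (q @: <[t]>) =
    (det3 a x t * det3 a z y) / (det3 a x y * det3 a z t).
Proof.
move=> d0 q; have [k k0 qE] := det2_quotient_map d0.
rewrite !limg_line cross_ratio_line0 !qE.
rewrite ![k * _ * (k * _)]mulrACA.
by rewrite -[LHS]mulf_div divff ?mul1r // mulf_neq0.
Qed.

Lemma limg_quotient_add a b c x : det3 a b c != 0 ->
  let q := quotient_map <[a]> in (q @: (<[x]> + <[a]>) = q @: <[x]>)%VS.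
Proof.
move=> d0 q; rewrite limgD [X in (_ + X)%VS]limg_line.
have -> : q a = 0 by apply/eqP; rewrite -memv_ker (quotient_mapE d0) memv_line.
by rewrite (addv_idPl _) // -memvE mem0v.
Qed.

(** Here the quotient is by the line [A 1], with [det3 a1] as area form; each plane through that
    line is represented by one further spanning vector. *)
Lemma cross_ratio10E A B C D a1 a2 b1 b2 c1 c2 d1 d2 :
  frame A a1 a2 -> frame B b1 b2 -> frame C c1 c2 -> frame D d1 d2 ->
  flag_cross_ratio 1 0 A B C D =
   (det3 a1 a2 d1 * det3 a1 c1 b1) / (det3 a1 a2 b1 * det3 a1 c1 d1).
Proof.
move=> fA fB fC fD; have [w w0] := frame_compl fA.
rewrite /flag_cross_ratio.
have -> : C 0 = 0%VS by [].
rewrite !addv0 (proj1 fA) (proj2 fA) (proj1 fB) (proj1 fC) (proj1 fD).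
rewrite [(<[a1]> + <[a2]>)%VS]addvC [(<[a1]> + <[c1]>)%VS]addvC.
by rewrite !(limg_quotient_add _ w0) (cross_ratio_quotient _ _ _ _ w0).
Qed.

Lemma cross_ratio01E A B C D a1 a2 b1 b2 c1 c2 d1 d2 :
  frame A a1 a2 -> frame B b1 b2 -> frame C c1 c2 -> frame D d1 d2 ->
  flag_cross_ratio 0 1 A B C D =
   (det3 c1 a1 d1 * det3 c1 c2 b1) / (det3 c1 a1 b1 * det3 c1 c2 d1).
Proof.
move=> fA fB fC fD; have [w w0] := frame_compl fC.
rewrite /flag_cross_ratio.
have -> : A 0 = 0%VS by [].
rewrite !add0v !addv0 (proj1 fA) (proj1 fB) (proj2 fC) (proj1 fC) (proj1 fD).
rewrite [(<[c1]> + <[c2]>)%VS]addvC.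
by rewrite !(limg_quotient_add _ w0) (cross_ratio_quotient _ _ _ _ w0).
Qed.

End Frames.

(** * Flags determined by their invariants *)

Section Uniqueness.
Set Implicit Arguments.
Unset Strict Implicit.
Variable F : fieldType.
Implicit Types (A B C D : flag F) (a b c d e v w x : 'cV[F]_3).

Lemma frameZ A a1 a2 k l : k != 0 -> l != 0 -> frame A a1 a2 ->
  frame A (k *: a1) (l *: a2).
Proof.
move=> k0 l0 fA; have [m1 _ m2] := frame_mem fA.
apply: frameP; [exact: memvZ| |exact: memvZ|].
  by rewrite scaler_eq0 negb_or k0 (frame_neq0 fA).
by rewrite rpredZeq negb_or l0 (frame_notin fA).
Qed.

Lemma exists_flag a b c : det3 a b c != 0 -> exists B, frame B a b.
Proof.
move=> d0.
have a0 : a != 0 by apply: contraNneq d0 => ->; rewrite -(scale0r a) det3Zl mul0r.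
have d1 : \dim <[a]> = 1%N by rewrite dim_vline a0.
have d2 : \dim (<[a]> + <[b]>) = 2%N.
  rewrite dim_add_line ?d1 //; apply: contraNN d0 => /vlineP[k ->].
  by rewrite det3Zm det3_eq0 mulr0.
by exists (Flag d1 d2 (addvSl _ _)).
Qed.

(* Both linear forms vanish at [b], hence they are determined up to a factor
   by their values at [a] and [c]. *)
Lemma plane_eq B B' a c b b2 b2' :
  frame B b b2 -> frame B' b b2' -> det3 a c b != 0 ->
  det3 b b2 a != 0 -> det3 b b2' a != 0 ->
  det3 b b2 c * det3 b b2' a = det3 b b2' c * det3 b b2 a ->
  B 2 = B' 2.
Proof.
move=> fB fB' d0 Y0 Y0' e.
have E x : det3 b b2 x * det3 b b2' a = det3 b b2' x * det3 b b2 a.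
  rewrite (cramer3V x d0); move: (_ / _) (_ / _) (_ / _) => k l m.
  rewrite -[_ *: a + _]scale1r !det3_lin !det3_eq0 !mulr0 !addr0 !mul1r.
  by rewrite !mulrDl -!(mulrA l) e; ring.
apply/vspaceP => x; rewrite (mem_flag2 _ fB) (mem_flag2 _ fB').
by rewrite -(mulIr_eq0 _ (mulIf Y0')) E mulf_eq0 (negbTE Y0) orbF.
Qed.

(** Up to signs and a common factor, the determinants of [b] with pairs from the basis [a], [e], [c]
    are its coordinates; the two cross ratios give their quotients, hence the line. The triple ratio
    then gives the plane by [plane_eq]. *)
Lemma flag_unique A B B' C D a e c b b2 d d2 :
  frame A a e -> frame C c e -> frame B b b2 -> frame D d d2 ->
  det3 a e c != 0 ->
  [/\ det3 a e d != 0, det3 a c d != 0 & det3 c e d != 0] ->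
  [/\ det3 a e b != 0, det3 a c b != 0 & det3 c e b != 0] ->
  det3 b b2 a != 0 -> det3 b b2 c != 0 ->
  flag_cross_ratio 1 0 A B' C D = flag_cross_ratio 1 0 A B C D ->
  flag_cross_ratio 0 1 A B' C D = flag_cross_ratio 0 1 A B C D ->
  triple_ratio A B' C = triple_ratio A B C ->
  B' 1 = B 1 /\ B' 2 = B 2.
Proof.
move=> fA fC fB fD dl0 [P0 Q0 T0] [p0 q0 r0] Y0 X0.
have [b' [b2' fB']] := exists_frame B'.
rewrite (cross_ratio10E fA fB fC fD) (cross_ratio10E fA fB' fC fD).
rewrite (cross_ratio01E fA fB fC fD) (cross_ratio01E fA fB' fC fD).
rewrite (det3_swap a c) (det3_swap a c b) (det3_swap a c b').
set p := det3 a e b in p0 *; set q := det3 a c b in q0 *.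
set r := det3 c e b in r0 *; set p' := det3 a e b'; set q' := det3 a c b'.
set r' := det3 c e b'.
set P := det3 a e d in P0 *; set Q := det3 a c d in Q0 *; set T := det3 c e d in T0 *.
move=> e1 e2 e3.
(* Division by zero gives zero, while the invariants of [B] are nonzero; equality therefore prevents
   the denominators for [B'] from vanishing. *)
have p'0 : p' != 0.
  apply/eqP => z; move/eqP: e1; rewrite z mul0r invr0 mulr0 eq_sym.
  by rewrite !mulf_eq0 invr_eq0 mulf_eq0 (negbTE P0) (negbTE p0) (negbTE q0) (negbTE Q0).
have q'0 : q' != 0.
  apply/eqP => z; move/eqP: e2; rewrite z oppr0 mul0r invr0 mulr0 eq_sym.
  by rewrite !mulf_eq0 invr_eq0 mulf_eq0 !oppr_eq0 (negbTE Q0) (negbTE r0)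
       (negbTE q0) (negbTE T0).
have e1' : q' * p = q * p'.
  have h0 : p' * Q != 0 by rewrite mulf_neq0.
  have h1 : p * Q != 0 by rewrite mulf_neq0.
  move/eqP: e1; rewrite eqr_div // => /eqP e1.
  by apply: (mulfI (mulf_neq0 P0 Q0)); transitivity
    (P * q' * (p * Q)); [ring|rewrite e1; ring].
have e2' : r' * q = r * q'.
  have h0 : - q' * T != 0 by rewrite mulf_neq0 ?oppr_eq0.
  have h1 : - q * T != 0 by rewrite mulf_neq0 ?oppr_eq0.
  move/eqP: e2; rewrite eqr_div // => /eqP e2.
  by apply: (mulfI (mulf_neq0 Q0 T0)); transitivity
    (- Q * r' * (- q * T)); [ring|rewrite e2; ring].
(* By [e1'] and [e2'] the three determinants are all scaled by the same factor [l], whence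
   [b' = l *: b] by Cramer's rule. *)
pose l := q' / q; have l0 : l != 0 by rewrite mulf_neq0 ?invr_eq0.
have bE : b' = l *: b.
  have pE : p' = l * p by apply: (mulfI q0); rewrite -e1' /l; field.
  have qE : q' = l * q by rewrite /l; field.
  have rE : r' = l * r by apply: (mulIf q0); rewrite e2' /l; field.
  rewrite (cramer3V b' dl0) (cramer3V b dl0) !scalerDr !scalerA.
  have swp v : det3 v e c = - det3 c e v by rewrite !det3E; ring.
  have swq v : det3 a v c = - det3 a c v by rewrite !det3E; ring.
  rewrite (swp b) (swp b') (swq b) (swq b') -/p -/p' -/q -/q' -/r -/r' pE rE qE.
  by congr (_ *: _ + _ *: _ + _ *: _); field.
have fB'' : frame B' b b2'.
  have := frameZ (invr_neq0 l0) (oner_neq0 _) fB'.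
  by rewrite bE scalerA mulVf // !scale1r.
split; first by rewrite (proj1 fB'') (proj1 fB).
have acb : det3 a c b != 0 by [].
(* With the line settled, the triple ratio fixes the quotient of the values at [a] and [c] of the
   form defining the plane. *)
move: e3; rewrite (triple_ratioE fA fB fC) (triple_ratioE fA fB'' fC) -/p -/r.
have -> : det3 c e a = - det3 a e c by rewrite !det3E; ring.
set dl := det3 a e c in dl0 *.
move=> e3; have Y0' : det3 b b2' a != 0.
  apply/eqP => z; move/eqP: e3; rewrite z mulr0 mul0r invr0 mulr0 eq_sym.
  by rewrite !mulf_eq0 invr_eq0 !mulf_eq0 !oppr_eq0 (negbTE dl0)
       (negbTE r0) (negbTE p0) (negbTE Y0) (negbTE X0).
apply: (plane_eq fB'' fB acb Y0' Y0).
have h0 : dl * det3 b b2 a * r != 0 by rewrite !mulf_neq0.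
have h1 : dl * det3 b b2' a * r != 0 by rewrite !mulf_neq0.
move/eqP: e3; rewrite eqr_div // => /eqP e3.
have n0 : - p * dl * dl * r != 0 by rewrite !mulf_neq0 ?oppr_eq0.
by apply: (mulfI n0); transitivity
    (p * det3 b b2' c * - dl * (dl * det3 b b2 a * r)); [ring|rewrite e3; ring].
Qed.

(** Once the line is known, the triple ratio is a nonzero constant times the quotient of the values
    at [a] and [c] of the form defining the plane. It serves for [D], whose line is fixed by the
    choice of basis. *)
Lemma plane_unique A B B' C a e c b b2 :
  frame A a e -> frame C c e -> frame B b b2 -> det3 a e c != 0 ->
  [/\ det3 a e b != 0, det3 a c b != 0 & det3 c e b != 0] ->
  det3 b b2 a != 0 -> det3 b b2 c != 0 -> B' 1 = B 1 ->
  triple_ratio A C B' = triple_ratio A C B ->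
  B' 2 = B 2.
Proof.
move=> fA fC fB dl0 [p0 q0 r0] Y0 X0 B1 e3.
have [b' [b2' fB']] := exists_frame B'.
have fB'' : frame B' b b2'.
  have [_ _ m2] := frame_mem fB'.
  by apply: frameP m2 (frame_notin fB'); rewrite ?(frame_neq0 fB) // B1 (proj1 fB) memv_line.
move: e3; rewrite (triple_ratioE fA fC fB) (triple_ratioE fA fC fB'').
have -> : det3 c e a = - det3 a e c by rewrite !det3E; ring.
set dl := det3 a e c in dl0 *; set p := det3 a e b in p0 *; set r := det3 c e b in r0 *.
move=> e3; have X0' : det3 b b2' c != 0.
  apply/eqP => z; move/eqP: e3; rewrite z mulr0 invr0 mulr0 eq_sym.
  by rewrite !mulf_eq0 invr_eq0 !mulf_eq0 !oppr_eq0 (negbTE dl0)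
       (negbTE r0) (negbTE p0) (negbTE Y0) (negbTE X0).
have cab : det3 c a b != 0 by rewrite det3_swap oppr_eq0.
apply: (plane_eq fB'' fB cab X0' X0).
have h0 : p * - dl * det3 b b2 c != 0 by rewrite !mulf_neq0 ?oppr_eq0.
have h1 : p * - dl * det3 b b2' c != 0 by rewrite !mulf_neq0 ?oppr_eq0.
move/eqP: e3; rewrite eqr_div // => /eqP e3.
have n0 : - p * dl * dl * r != 0 by rewrite !mulf_neq0 ?oppr_eq0.
by apply: (mulfI n0); transitivity
    (dl * r * det3 b b2' a * (p * - dl * det3 b b2 c)); [ring|rewrite e3; ring].
Qed.

(** Listing the four indices as separate numbers lets each incidence be read off as a nonvanishing
    determinant. *)
Lemma generic_sum A B C D (i j k l : nat) :
  generic_position [tuple A; B; C; D] -> (i + (j + (k + l)))%N = 3 ->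
  (A i + (B j + (C k + D l)))%VS = fullv.
Proof.
move=> g s; have := g (fun x : 'I_4 => nth 0%N [:: i; j; k; l] x).
rewrite !big_ord_recl !big_ord0 /= addn0 => /(_ s)[_].
by rewrite !big_ord_recl !big_ord0 addv0 !(tnth_nth A) /=.
Qed.

Lemma det3_111 A B C a a2 b b2 c c2 :
  frame A a a2 -> frame B b b2 -> frame C c c2 ->
  (A 1 + B 1 + C 1)%VS = fullv -> det3 a b c != 0.
Proof. by move=> [-> _] [-> _] [-> _]; apply: span_full_det3. Qed.

Lemma det3_21 A B a a2 b b2 : frame A a a2 -> frame B b b2 ->
  (A 2 + B 1)%VS = fullv -> det3 a a2 b != 0.
Proof. by move=> [_ ->] [-> _]; apply: span_full_det3. Qed.

(** The vector [e] spans the intersection of [A 2] and [C 2]. A vector spanning [D 1] has only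
    nonzero coordinates in the basis [a], [e], [c]; scaling the basis by them makes it the unit
    point. *)
Lemma adapted_frames A C D : 
  (A 2 + C 1)%VS = fullv -> (C 2 + A 1)%VS = fullv ->
  (A 2 + D 1)%VS = fullv -> (C 2 + D 1)%VS = fullv ->
  (A 1 + C 1 + D 1)%VS = fullv ->
  exists a e c d2, [/\ frame A a e, frame C c e, frame D (a + e + c) d2 & det3 a e c != 0].
Proof.
move=> gAC gCA gAD gCD gACD.
have [a [a2 fA]] := exists_frame A; have [c [c2 fC]] := exists_frame C.
have [d [d2 fD]] := exists_frame D.
have aca := det3_21 fA fC gAC; have cac := det3_21 fC fA gCA.
(* The combination of [a2] and [a] on which the equation [det3 c c2] of [C 2] vanishes. *)
pose e := det3 c c2 a *: a2 + (- det3 c c2 a2) *: a.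
have ae : det3 a e c = det3 c c2 a * det3 a a2 c.
  by rewrite /e -det3_rot -det3_rot det3_lin det3_eq0 mulr0 addr0 -(det3_rot c a a2).
have ae0 : det3 a e c != 0 by rewrite ae mulf_neq0.
have [mA _ _] := frame_mem fA; have [mC _ _] := frame_mem fC.
have fAe : frame A a e.
  apply: frameP => //; first exact: frame_neq0 fA.
    by rewrite (mem_flag2 _ fA) /e det3_lin !det3_eq0 !mulr0 addr0.
  rewrite (proj1 fA); apply: contraNN ae0 => /vlineP[k ->].
  by rewrite det3Zm det3_eq0 mulr0.
have fCe : frame C c e.
  apply: frameP => //; first exact: frame_neq0 fC.
    by rewrite (mem_flag2 _ fC) /e det3_lin; apply/eqP; ring.
  rewrite (proj1 fC); apply: contraNN ae0 => /vlineP[k ->].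
  by rewrite det3Zm det3_eq0 mulr0.
have z0 := det3_21 fAe fD gAD; have x0 := det3_21 fCe fD gCD.
have y0 := det3_111 fA fC fD gACD.
have dE := cramer3V d ae0.
have i0 : (det3 a e c)^-1 != 0 by rewrite invr_eq0.
set x := _ / _ in dE; set y := det3 a d c / _ in dE; set z := det3 a e d / _ in dE.
have X0 : x != 0.
  rewrite mulf_neq0 //; suff -> : det3 d e c = - det3 c e d by rewrite oppr_eq0.
  by rewrite !det3E; ring.
have Y0 : y != 0.
  rewrite mulf_neq0 //; suff -> : det3 a d c = - det3 a c d by rewrite oppr_eq0.
  by rewrite !det3E; ring.
have Z0 : z != 0 by rewrite mulf_neq0.
exists (x *: a), (y *: e), (z *: c), d2; rewrite -dE; split=> //.
- exact: frameZ.
- exact: frameZ.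
- by rewrite det3Zl det3Zm det3Zr; exact: mulf_neq0 X0 (mulf_neq0 Y0 (mulf_neq0 Z0 ae0)).
Qed.

End Uniqueness.

(** * Antilinear involutions acting on flags *)

Section RealStructure.
Set Implicit Arguments.
Unset Strict Implicit.
Variable K : numClosedFieldType.
Implicit Types (A B C D : flag K) (a b c d v w : 'cV[K]_3) (G M : 'M[K]_3).

Notation conj_mx := (map_mx (@Num.conj K)).

Lemma conj_mxK m n : involutive (conj_mx : 'M_(m, n) -> 'M_(m, n)).
Proof. by move=> A; apply/matrixP => i j; rewrite !mxE conjCK. Qed.

(* The antilinear involution whose fixed vectors are the image under [G] of
   the real ones. *)
Definition gconj G v : 'cV[K]_3 := G *m conj_mx (invmx G *m v).

Lemma gconjD G v w : gconj G (v + w) = gconj G v + gconj G w.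
Proof. by rewrite /gconj mulmxDr map_mxD mulmxDr. Qed.

Lemma gconjZ G k v : gconj G (k *: v) = k^* *: gconj G v.
Proof. by rewrite /gconj -scalemxAr map_mxZ -scalemxAr. Qed.

Lemma gconj_mulmx G v : G \in unitmx -> gconj G (G *m v) = G *m conj_mx v.
Proof. by move=> uG; rewrite /gconj mulKmx. Qed.

Lemma gconjK G : G \in unitmx -> involutive (gconj G).
Proof. by move=> uG v; rewrite {2}/gconj gconj_mulmx // conj_mxK mulKVmx. Qed.

Lemma gconj_neq0 G v : G \in unitmx -> v != 0 -> gconj G v != 0.
Proof.
move=> uG; apply: contra => /eqP e; rewrite -[v](gconjK uG) e.
by have := gconjZ G 0 0; rewrite conjC0 !scale0r => ->.
Qed.

(** The factor depends only on [G], so it cancels in a quotient with as many determinants above as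
    below; this is why cross ratios and triple ratios get conjugated. *)
Lemma det3_gconj G : G \in unitmx -> exists2 k, k != 0 &
  forall a b c, det3 (gconj G a) (gconj G b) (gconj G c) = k * (det3 a b c)^*.
Proof.
move=> uG; exists (\det G * (\det (invmx G))^*).
  rewrite mulf_neq0 ?conjC_eq0 -?unitfE -?unitmxE //.
  by rewrite unitmx_inv.
move=> a b c; rewrite /gconj det3_mulmx -mulrA; congr (_ * _).
rewrite -rmorphM -det3_mulmx /det3 -det_map_mx; congr (\det _).
by apply/matrixP => i j; rewrite !mxE; do !case: ifP => // _; rewrite !mxE.
Qed.

(** Inclusions suffice: for invertible [G] the involution is a semilinear bijection and the
    dimensions agree, so [B'] is the image of [B]. *)
Definition fconj G B B' : Prop :=
  (forall v, v \in B 1 -> gconj G v \in B' 1) /\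
  (forall v, v \in B 2 -> gconj G v \in B' 2).

Lemma fconj_frame G B B' b b2 : G \in unitmx -> fconj G B B' ->
  frame B b b2 -> frame B' (gconj G b) (gconj G b2).
Proof.
move=> uG [h1 h2] fB; have [m1 m1' m2] := frame_mem fB.
have n0 := gconj_neq0 uG (frame_neq0 fB).
apply: (frameP (h1 _ m1) n0 (h2 _ m2)).
have e1 : B' 1 = _ := span1P (dim_flag1 B') (h1 _ m1) n0; rewrite e1.
apply: contraNN (frame_notin fB) => /vlineP[k e].
by rewrite -[b2](gconjK uG) e gconjZ gconjK // memvZ.
Qed.

Lemma frame_fconj G B B' b b2 : frame B b b2 ->
  gconj G b \in B' 1 -> gconj G b2 \in B' 2 -> fconj G B B'.
Proof.
move=> [e1 e2] h1 h2; have h1' := subvP (flag12 B') _ h1.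
split=> v; rewrite ?e1 ?e2.
  by case/vlineP => k ->; rewrite gconjZ memvZ.
case/memv_line2 => k [l ->]; rewrite gconjD !gconjZ.
by apply: memvD; apply: memvZ.
Qed.

Lemma fconj_exists G B : G \in unitmx -> exists B', fconj G B B'.
Proof.
move=> uG; have [b [b2 fB]] := exists_frame B.
have [w w0] := frame_compl fB; have [k k0 kE] := det3_gconj uG.
have : det3 (gconj G b) (gconj G b2) (gconj G w) != 0 by rewrite kE mulf_neq0 ?conjC_eq0.
case/exists_flag => B' fB'; exists B'; have [m1 _ m2] := frame_mem fB'.
exact: frame_fconj fB m1 m2.
Qed.

Lemma fconj_eq G B B' B'' : fconj G B B' -> B' 1 = B'' 1 -> B' 2 = B'' 2 ->
  fconj G B B''.
Proof. by move=> [h1 h2] e1 e2; split; rewrite -?e1 -?e2. Qed.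

Lemma fconj_sym G B B' : G \in unitmx -> fconj G B B' -> fconj G B' B.
Proof.
move=> uG fc; have [b [b2 fB]] := exists_frame B.
have fB' := fconj_frame uG fc fB; have [m1 _ m2] := frame_mem fB.
by apply: frame_fconj fB' _ _; rewrite gconjK.
Qed.

Lemma ratio_conj (k x y z u : K) : k != 0 ->
  (k * x^* * (k * y^*)) / (k * z^* * (k * u^*)) = ((x * y) / (z * u))^*.
Proof.
move=> k0; rewrite fmorph_div !rmorphM /= mulrACA (mulrACA k _ k).
by rewrite -[LHS]mulf_div divff ?mul1r // mulf_neq0.
Qed.

Lemma triple_ratio_conj G A A' B B' C C' : G \in unitmx ->
  fconj G A A' -> fconj G B B' -> fconj G C C' ->
  triple_ratio A' B' C' = (triple_ratio A B C)^*.
Proof.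
move=> uG cA cB cC; have [k k0 kE] := det3_gconj uG.
have [a [a2 fA]] := exists_frame A; have [b [b2 fB]] := exists_frame B.
have [c [c2 fC]] := exists_frame C.
have fA' := fconj_frame uG cA fA; have fB' := fconj_frame uG cB fB.
have fC' := fconj_frame uG cC fC.
rewrite (triple_ratioE fA fB fC) (triple_ratioE fA' fB' fC') !kE.
rewrite fmorph_div !rmorphM /=.
have k3 : k ^+ 3 != 0 by rewrite expf_neq0.
have E x y z : k * x * (k * y) * (k * z) = k ^+ 3 * (x * y * z) by ring.
by rewrite !E -[LHS]mulf_div divff ?mul1r.
Qed.

Lemma cross_ratio10_conj G A A' B B' C C' D D' : G \in unitmx ->
  fconj G A A' -> fconj G B B' -> fconj G C C' -> fconj G D D' ->
  flag_cross_ratio 1 0 A' B' C' D' = (flag_cross_ratio 1 0 A B C D)^*.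
Proof.
move=> uG cA cB cC cD; have [k k0 kE] := det3_gconj uG.
have [a [a2 fA]] := exists_frame A; have [b [b2 fB]] := exists_frame B.
have [c [c2 fC]] := exists_frame C; have [d [d2 fD]] := exists_frame D.
rewrite (cross_ratio10E fA fB fC fD).
rewrite (cross_ratio10E (fconj_frame uG cA fA) (fconj_frame uG cB fB)
           (fconj_frame uG cC fC) (fconj_frame uG cD fD)) !kE.
exact: ratio_conj.
Qed.

Lemma cross_ratio01_conj G A A' B B' C C' D D' : G \in unitmx ->
  fconj G A A' -> fconj G B B' -> fconj G C C' -> fconj G D D' ->
  flag_cross_ratio 0 1 A' B' C' D' = (flag_cross_ratio 0 1 A B C D)^*.
Proof.
move=> uG cA cB cC cD; have [k k0 kE] := det3_gconj uG.
have [a [a2 fA]] := exists_frame A; have [b [b2 fB]] := exists_frame B.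
have [c [c2 fC]] := exists_frame C; have [d [d2 fD]] := exists_frame D.
rewrite (cross_ratio01E fA fB fC fD).
rewrite (cross_ratio01E (fconj_frame uG cA fA) (fconj_frame uG cB fB)
           (fconj_frame uG cC fC) (fconj_frame uG cD fD)) !kE.
exact: ratio_conj.
Qed.

(* With [A], [C] and the line of [D] spanned by real vectors in the basis [G],
   [A], [C] and [D 1] are self-conjugate, and the invariants determine the rest. *)
Lemma real_structure_exists A B C D :
  generic_position [tuple A; B; C; D] ->
  (triple_ratio A C D)^* = triple_ratio A C D ->
  exists2 G, G \in unitmx &
    [/\ fconj G A A, fconj G C C, fconj G D D &
     forall b b' : flag K, generic_position [tuple A; b'; C; D] ->
       flag_cross_ratio 1 0 A b' C D = (flag_cross_ratio 1 0 A b C D)^* ->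
       flag_cross_ratio 0 1 A b' C D = (flag_cross_ratio 0 1 A b C D)^* ->
       triple_ratio A b' C = (triple_ratio A b C)^* ->
       fconj G b b'].
Proof.
move=> g rACD.
have gs A0 B0 C0 D0 i j k l (h : generic_position [tuple A0; B0; C0; D0])
   (s : (i + (j + (k + l)))%N = 3) := generic_sum h s.
have v0 (U : flag K) : U 0 = 0%VS by [].
(* Each choice of indices with sum 3 isolates one incidence, the summands of index 0 dropping
   out. *)
have gAC := gs _ _ _ _ 2 0 1 0 g erefl; rewrite !v0 !addv0 add0v in gAC.
have gCA := gs _ _ _ _ 1 0 2 0 g erefl; rewrite !v0 !addv0 add0v addvC in gCA.
have gAD := gs _ _ _ _ 2 0 0 1 g erefl; rewrite !v0 !add0v in gAD.
have gDA := gs _ _ _ _ 1 0 0 2 g erefl; rewrite !v0 !add0v addvC in gDA.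
have gCD := gs _ _ _ _ 0 0 2 1 g erefl; rewrite !v0 !add0v in gCD.
have gDC := gs _ _ _ _ 0 0 1 2 g erefl; rewrite !v0 !add0v addvC in gDC.
have gACD := gs _ _ _ _ 1 0 1 1 g erefl; rewrite !v0 !add0v addvA in gACD.
have [a [e [c [d2 [fA fC fD ae0]]]]] := adapted_frames gAC gCA gAD gCD gACD.
pose G := mx3 a e c; have uG : G \in unitmx by rewrite unitmxE unitfE.
(* The columns of [G] are the images of the standard basis vectors, which are real. *)
have colG j : gconj G (col j G) = col j G.
  rewrite colE gconj_mulmx //; congr (_ *m _); apply/matrixP => i l.
  by rewrite !mxE; case: (_ && _); rewrite ?conjC1 ?conjC0.
have sa : gconj G a = a.
  have <- : col 0 G = a by apply/colP => i; rewrite !mxE.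
  exact: colG.
have se : gconj G e = e.
  have <- : col 1 G = e by apply/colP => i; rewrite !mxE.
  exact: colG.
have sc : gconj G c = c.
  have <- : col 2%:R G = c by apply/colP => i; rewrite !mxE.
  exact: colG.
have sd : gconj G (a + e + c) = a + e + c by rewrite !gconjD sa se sc.
have [ma _ me] := frame_mem fA; have [mc _ me'] := frame_mem fC.
have cA : fconj G A A by apply: frame_fconj fA _ _; rewrite ?sa ?se.
have cC : fconj G C C by apply: frame_fconj fC _ _; rewrite ?sc ?se.
set d := a + e + c in fD sd.
have dets : [/\ det3 a e d != 0, det3 a c d != 0 & det3 c e d != 0].
  by split; [exact: det3_21 fA fD _|exact: det3_111 fA fC fD _|exact: det3_21 fC fD _].
have dd2a := det3_21 fD fA gDA; have dd2c := det3_21 fD fC gDC.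
(* The image [D'] has the same line, since the involution fixes the unit point, and the same triple
   ratio by [rACD], hence the same plane. *)
have cD : fconj G D D.
  have [D' cD'] := fconj_exists D uG; have [md _ _] := frame_mem fD.
  have e1 : D' 1 = D 1.
    rewrite (proj1 fD); apply: span1P (dim_flag1 D') _ (frame_neq0 fD).
    by have := proj1 cD' _ md; rewrite sd.
  apply: (fconj_eq cD' e1); apply: (plane_unique fA fC fD) => //.
  by rewrite (triple_ratio_conj uG cA cC cD').
exists G => //; split=> // b b' gb x10 x01 tr.
have gAb := gs _ _ _ _ 2 1 0 0 gb erefl; rewrite !v0 !addv0 in gAb.
have gbA := gs _ _ _ _ 1 2 0 0 gb erefl; rewrite !v0 !addv0 addvC in gbA.
have gCb := gs _ _ _ _ 0 1 2 0 gb erefl; rewrite !v0 !addv0 add0v addvC in gCb.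
have gbC := gs _ _ _ _ 0 2 1 0 gb erefl; rewrite !v0 !addv0 add0v in gbC.
have gAbC := gs _ _ _ _ 1 1 1 0 gb erefl; rewrite !v0 !addv0 (addvC (b' 1)) addvA in gAbC.
have [b1 [b2 fb]] := exists_frame b'.
(* The image [S] of [b] has the conjugated invariants, which by assumption are those of [b'];
   generic position of [b'] then gives equality. *)
have [S cS] := fconj_exists b uG.
have [e1 e2] : S 1 = b' 1 /\ S 2 = b' 2.
  apply: (flag_unique fA fC fb fD) => //.
  - by split; [exact: det3_21 fA fb _|exact: det3_111 fA fC fb _|exact: det3_21 fC fb _].
  - exact: det3_21 fb fA _.
  - exact: det3_21 fb fC _.
  - by rewrite (cross_ratio10_conj uG cA cS cC cD).
  - by rewrite (cross_ratio01_conj uG cA cS cC cD).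
  - by rewrite (triple_ratio_conj uG cA cS cC).
exact: fconj_eq cS e1 e2.
Qed.

End RealStructure.

(** * Real conjugates in terms of the involution *)

Section Criterion.
Set Implicit Arguments.
Unset Strict Implicit.
Local Open Scope quotient_scope.
Variable R : realType.
Local Notation K := R[i].
Implicit Types (b : flag K) (m v w : 'cV[K]_3) (u z : K) (M : PGL K 3) (g : GL K 3).

Notation conj_mx := (map_mx (@Num.conj K)).

Lemma conj_real_complex (t : R) : (real_complex R t)^* = real_complex R t.
Proof.
by apply/CrealP; rewrite complex_real.
Qed.

Lemma real_complex_Re z : z^* = z -> real_complex R (complex.Re z) = z.
Proof. by move/CrealP => h; apply: RRe_real. Qed.

Lemma on_lineP u z : u != 0 -> on_line u z <-> reflection u z = z.
Proof.
move=> u0; have u'0 : u^* != 0 by rewrite conjC_eq0.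
rewrite /reflection; split=> [[t ->]|e].
  by rewrite rmorphM /= conj_real_complex; field; rewrite ?u'0.
exists (complex.Re (z / u)); rewrite real_complex_Re ?divfK //.
by rewrite fmorph_div -{2}e; field; rewrite ?u'0 ?u0.
Qed.

Lemma reflectionK u : u != 0 -> involutive (reflection u).
Proof.
move=> u0 z; have u'0 : u^* != 0 by rewrite conjC_eq0.
by rewrite /reflection rmorphM /= fmorph_div /= !conjCK; field; rewrite ?u'0 ?u0.
Qed.

(** A matrix is [u] times a real one exactly when it is [u / u^*] times its conjugate; transported
    by [g], this says that [M] commutes with the involution up to that scalar. The scalar is written
    so as to match [reflection u]. *)
Lemma in_PGL_realP g M :
  in_PGL_real ((\pi_(PGL K 3) g)^-1 * M * \pi_(PGL K 3) g)%g <->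
  exists2 u, u != 0 &
    forall v, mx_of M *m gconj (val g) v = (u / u^*) *: gconj (val g) (mx_of M *m v).
Proof.
have ug := valP g; rewrite /mx_of; set N := repr M.
have -> : ((\pi_(PGL K 3) g)^-1 * M * \pi_(PGL K 3) g)%g = \pi_(PGL K 3) (g^-1 * N * g)%g.
  rewrite -[M]reprK -/N.
  have pM (x y : GL K 3) : (\pi_(PGL K 3) x * \pi_(PGL K 3) y)%g = \pi_(PGL K 3) (x * y)%g.
    exact: esym (pi_pgl_mul x y).
  have pV (x : GL K 3) : ((\pi_(PGL K 3) x)^-1)%g = \pi_(PGL K 3) (x^-1)%g.
    exact: esym (pi_pgl_inv x).
  by rewrite pV !pM.
(* Writing [v = val g *m x] turns the condition on the involution into one on [P], whose columns
   come from the basis vectors [x]. *)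
have crit' (P : 'M[K]_3) u : val g *m P = val N *m val g ->
    (forall v, val N *m gconj (val g) v = (u / u^*) *: gconj (val g) (val N *m v))
    <-> P = (u / u^*) *: conj_mx P.
  move=> PE; split=> [h|h v].
    apply/matrixP => i j; have := h (val g *m delta_mx j 0).
    rewrite gconj_mulmx // mulmxA -PE mulmxA -PE -!mulmxA gconj_mulmx // scalemxAr.
    move/(can_inj (mulKmx ug)); rewrite map_mxM.
    have -> : conj_mx (delta_mx j 0 : 'cV[K]_3) = delta_mx j 0.
      by apply/matrixP => k l; rewrite !mxE; case: (_ && _); rewrite ?conjC1 ?conjC0.
    by rewrite scalemxAl -!colE => /colP/(_ i); rewrite !mxE.
  rewrite -[v](mulKVmx ug); move: (invmx _ *m v) => x.
  rewrite gconj_mulmx // mulmxA -PE mulmxA -PE -!mulmxA gconj_mulmx // scalemxAr.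
  by congr (_ *m _); rewrite map_mxM scalemxAl -h.
have [P PdE] : exists P, invmx (val g) *m val N *m val g = P by eexists.
have PE : val g *m P = val N *m val g by rewrite -PdE !mulmxA mulmxV // mul1mx.
have crit u := crit' P u PE.
split=> [[A /eqmodP/asboolP[c c0 /= e]]|[u u0 /crit e]].
  exists c => //; apply/crit; rewrite PdE in e; rewrite e map_mxZ scalerA.
  have c'0 : c^* != 0 by rewrite conjC_eq0.
  rewrite (divfK c'0); congr (_ *: _); apply/matrixP => i j.
  by rewrite !mxE /= conj_real_complex.
have u'0 : u^* != 0 by rewrite conjC_eq0.
(* The matrix [u^-1 *: P] equals its conjugate, so taking real parts loses nothing. *)
pose Q : 'M[R]_3 := map_mx (@complex.Re R) (u^-1 *: P).
have QE : map_mx (real_complex R) Q = u^-1 *: P.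
  apply/matrixP => i j; rewrite !mxE real_complex_Re // {2}e !mxE.
  by rewrite rmorphM /= fmorphV; field; rewrite ?u'0 ?u0.
have uQ : Q \in unitmx.
  rewrite -(map_unitmx (real_complex R)) QE unitmxZ ?unitfE ?invr_eq0 //.
  by rewrite -PdE !unitmx_mul unitmx_inv ug (valP N).
exists (exist (fun A : 'M_3 => A \in unitmx) Q uQ).
apply/eqmodP/asboolP; exists u => //=.
by rewrite QE PdE scalerA mulfV // scale1r.
Qed.

(** Bridges column eigenvectors and the row eigenvectors behind [eig]: a matrix and its transpose
    have the same determinant. *)
Lemma eigenvector_eig M z m : eigenvector M z m -> eig M z.
Proof.
move=> [m0 e]; apply/eigenvalueP.
have : \det (mx_of M - z%:M)^T == 0.
  apply/det0P; exists m^T; first by rewrite -(inj_eq (@trmx_inj _ _ _)) trmxK trmx0.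
  by rewrite -trmx_mul mulmxBl mul_scalar_mx e subrr trmx0.
rewrite det_tr => /det0P[r r0]; rewrite mulmxBr mul_mx_scalar => /subr0_eq rM.
by exists r.
Qed.

(** * The eigenbasis for three distinct eigenvalues *)

Section EigenBasis.
Variables (M : PGL K 3) (z1 z2 z3 : K) (m1 m2 m3 : 'cV[K]_3).
Hypotheses (uz : uniq [:: z1; z2; z3]).
Hypotheses (e1 : eigenvector M z1 m1) (e2 : eigenvector M z2 m2) (e3 : eigenvector M z3 m3).
Variables (b b' : flag K).
Hypotheses (fb : frame b m1 m2) (fb' : frame b' m3 m2).

Lemma eigenvalues_neq : [/\ z1 != z2, z1 != z3 & z2 != z3].
Proof. by move: uz; rewrite /= !inE negb_or andbT => /andP[/andP[? ?] ?]; split. Qed.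

Lemma det3_eigenbasis : det3 m1 m2 m3 != 0.
Proof.
rewrite -(mem_flag2 _ fb) (proj2 fb); apply/negP => /memv_line2[k [l e]].
have [n12 n13 n23] := eigenvalues_neq.
have : mx_of M *m m3 = z3 *: m3 by case: e3.
rewrite e mulmxDr -!scalemxAr (proj2 e1) (proj2 e2) scalerDr !scalerA => /eqP.
rewrite -subr_eq0 opprD addrACA -!scalerBl => /eqP e'.
(* An auxiliary [w], taken with coefficient zero, completes [m1], [m2] to a basis, so the relation
   forces both coefficients to vanish. *)
have [w w0] := frame_compl fb.
have [] := det3_neq0_basis (k := k * z1 - z3 * k) (l := l * z2 - z3 * l) (m := 0) w0.
  by rewrite scale0r addr0.
rewrite !(mulrC z3) -!mulrBr. move=> /eqP; rewrite mulf_eq0 subr_eq0 (negbTE n13) orbF.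
move=> /eqP k0 /eqP; rewrite mulf_eq0 subr_eq0 (negbTE n23) orbF => /eqP l0 _.
by case: e3 => /eqP; rewrite e k0 l0 !scale0r addr0.
Qed.

(** A row eigenvector for [z] pairs to zero with each [m] whose eigenvalue differs from [z]; it
    cannot vanish on the whole basis. *)
Lemma eigenvalue_cases z : eig M z -> [\/ z = z1, z = z2 | z = z3].
Proof.
case/eigenvalueP => r rM r0.
have h z' m : eigenvector M z' m -> z = z' \/ r *m m = 0.
  move=> [_ em]; have [->|zz'] := eqVneq z z'; first by left.
  right; have : r *m mx_of M *m m = z' *: (r *m m) by rewrite -mulmxA em -scalemxAr.
  rewrite rM -scalemxAl => /eqP; rewrite -subr_eq0 -scalerBl scaler_eq0 subr_eq0.
  by rewrite (negbTE zz') => /eqP.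
have [|r1] := h _ _ e1; first by constructor 1.
have [|r2] := h _ _ e2; first by constructor 2.
have [|r3] := h _ _ e3; first by constructor 3.
case/eqP: r0; apply/rowP => i; rewrite mxE.
have : r *m (delta_mx i 0 : 'cV[K]_3) = 0.
  have [k [l [n ->]]] := det3_span (delta_mx i 0) det3_eigenbasis.
  rewrite !mulmxDr -!scalemxAr r1 r2 r3.
  by rewrite 3!scaler0 2!addr0.
by rewrite -colE => /matrixP/(_ 0 0); rewrite !mxE.
Qed.

Lemma eigenspace_line v :
  [/\ mx_of M *m v = z1 *: v -> v \in <[m1]>%VS,
      mx_of M *m v = z2 *: v -> v \in <[m2]>%VS &
      mx_of M *m v = z3 *: v -> v \in <[m3]>%VS].
Proof.
have [n12 n13 n23] := eigenvalues_neq; have d0 := det3_eigenbasis.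
have [k [l [n ->]]] := det3_span v d0.
have main z : mx_of M *m (k *: m1 + l *: m2 + n *: m3) = z *: (k *: m1 + l *: m2 + n *: m3) ->
    [/\ k * (z1 - z) = 0, l * (z2 - z) = 0 & n * (z3 - z) = 0].
  rewrite !mulmxDr -!scalemxAr (proj2 e1) (proj2 e2) (proj2 e3) !scalerDr !scalerA.
  move/eqP; rewrite -subr_eq0 => /eqP e.
  apply: (det3_neq0_basis d0); rewrite -[RHS]e !mulrBr !scalerBl !opprD !addrA.
  rewrite !(mulrC z); apply/matrixP => i j; rewrite !mxE; ring.
have c (k' x y : K) : x != y -> k' * (x - y) = 0 -> k' = 0.
  by move=> xy /eqP; rewrite mulf_eq0 subr_eq0 (negbTE xy) orbF => /eqP.
split=> h; have [k0 l0 n0] := main _ h.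
- by rewrite (c _ _ _ _ l0) 1?eq_sym // (c _ _ _ _ n0) 1?eq_sym //
    !scale0r !addr0 memvZ ?memv_line.
- by rewrite (c _ _ _ _ k0) // (c _ _ _ _ n0) 1?eq_sym //
    !scale0r add0r addr0 memvZ ?memv_line.
- by rewrite (c _ _ _ _ k0) // (c _ _ _ _ l0) // !scale0r !add0r memvZ ?memv_line.
Qed.

(** Recovers the middle eigendirection from the flags, so that an involution preserving or
    exchanging them must preserve it. *)
Lemma flag2_cap v : v \in b 2 -> v \in b' 2 -> v \in <[m2]>%VS.
Proof.
rewrite (mem_flag2 _ fb) (mem_flag2 _ fb') => /eqP h /eqP h'.
rewrite (cramer3V v det3_eigenbasis) h.
have -> : det3 v m2 m3 = - det3 m3 m2 v by rewrite !det3E; ring.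
by rewrite h' oppr0 !mul0r !scale0r addr0 add0r memvZ ?memv_line.
Qed.

(** Both sides are antilinear in [v], so a basis suffices. *)
Lemma semilinear_eigenbasis g (u : K) :
  (forall m, m \in [:: m1; m2; m3] ->
     mx_of M *m gconj (val g) m = (u / u^*) *: gconj (val g) (mx_of M *m m)) ->
  forall v, mx_of M *m gconj (val g) v = (u / u^*) *: gconj (val g) (mx_of M *m v).
Proof.
move=> h v; have [k [l [n ->]]] := det3_span v det3_eigenbasis.
move: (h m1) (h m2) (h m3); rewrite !inE !eqxx !orbT.
move: (gconjD (val g)) (gconjZ (val g)); move: (gconj (val g)) (mx_of M) (u / u^*).
move=> S N r sD sZ /(_ isT) E1 /(_ isT) E2 /(_ isT) E3.
have scal x m : N *m S m = r *: S (N *m m) -> N *m S (x *: m) = r *: S (N *m (x *: m)).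
  by move=> E; rewrite sZ -[in LHS]scalemxAr E -scalemxAr sZ !scalerA mulrC.
have add x y : N *m S x = r *: S (N *m x) -> N *m S y = r *: S (N *m y) ->
    N *m S (x + y) = r *: S (N *m (x + y)).
  by move=> Ex Ey; rewrite sD mulmxDr Ex Ey mulmxDr sD scalerDr.
by apply: (add); [apply: (add)|]; apply: scal.
Qed.

(** The involution sends an eigenvector for [z] to one for [reflection u z], so the reflection
    preserves the set of eigenvalues. This supplies the line to which genericity is applied. *)
Lemma compatible_eigenbasis g u : u != 0 ->
  (forall v, mx_of M *m gconj (val g) v = (u / u^*) *: gconj (val g) (mx_of M *m v)) ->
  compatible_line M u.
Proof.
move=> u0 h; split=> // z.
have step z' m : eigenvector M z' m -> on_line u z' \/
    exists w : K, [/\ eig M w, w != z' & reflection u z' = w].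
  move=> [m0 em]; have [e|ne] := eqVneq (reflection u z') z'.
    by left; apply/on_lineP.
  right; exists (reflection u z'); split=> //.
  apply: (eigenvector_eig (m := gconj (val g) m)); split.
    exact: gconj_neq0 (valP g) m0.
  by rewrite h em gconjZ scalerA.
by case/eigenvalue_cases => ->; [exact: step e1|exact: step e2|exact: step e3].
Qed.

End EigenBasis.

(** * Criteria for a single hyperbolic or elliptic element *)

Lemma gconj_eigenvector M g u z m z' m' :
  mx_of M *m m = z *: m -> mx_of M *m m' = z' *: m' -> reflection u z = z' ->
  gconj (val g) m \in <[m']>%VS ->
  mx_of M *m gconj (val g) m = (u / u^*) *: gconj (val g) (mx_of M *m m).
Proof.
move=> e e' uz /vlineP[k sE].
by rewrite e gconjZ sE -scalemxAr e' -uz /reflection !scalerA; congr (_ *: _); ring.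
Qed.

(** If the conjugate is real, genericity gives its line [c] the same labelling as [u], so each
    eigenvalue is fixed by the reflection and each eigendirection by the involution. Conversely,
    preserved flags have preserved lines, and their planes meet in the middle eigendirection. *)
Lemma hyperbolic_criterion g M b b' :
  hyperbolic M -> generic_eigenvalues M -> eigenflag_pair M b b' ->
  in_PGL_real ((\pi_(PGL K 3) g)^-1 * M * \pi_(PGL K 3) g)%g <->
  fconj (val g) b b /\ fconj (val g) b' b'.
Proof.
move=> [u u0 hu] [_ _ gen] [z1 [z2 [z3 [m1 [m2 [m3 [uz [e1 e2 e3] _ fb fb']]]]]]].
have [h1 h2 h3] : [/\ eig M z1, eig M z2 & eig M z3].
  by split; [exact: eigenvector_eig e1|exact: eigenvector_eig e2|exact: eigenvector_eig e3].
rewrite in_PGL_realP; split=> [[c c0 hc]|[cb cb']].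
  have cu : compatible_line M u by split=> // z /hu; left.
  have cc := compatible_eigenbasis uz e1 e2 e3 fb c0 hc.
  have fix_ z m : eigenvector M z m -> mx_of M *m gconj (val g) m = z *: gconj (val g) m.
    move=> em; have hz := eigenvector_eig em.
    have /on_lineP rz := (gen _ _ cu cc _ hz).1 (hu _ hz).
    by rewrite hc (proj2 em) gconjZ scalerA; congr (_ *: _); exact: rz c0.
  have [s1 _ _] := eigenspace_line uz e1 e2 e3 fb (gconj (val g) m1).
  have [_ s2 _] := eigenspace_line uz e1 e2 e3 fb (gconj (val g) m2).
  have [_ _ s3] := eigenspace_line uz e1 e2 e3 fb (gconj (val g) m3).
  have {}s2 := s2 (fix_ _ _ e2).
  have [_ _ i2] := frame_mem fb; have [_ _ i2'] := frame_mem fb'.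
  split; [apply: (frame_fconj fb)|apply: (frame_fconj fb')].
  - by rewrite (proj1 fb); apply/s1/fix_.
  - by case/vlineP: s2 => k ->; apply: memvZ.
  - by rewrite (proj1 fb'); apply/s3/fix_.
  - by case/vlineP: s2 => k ->; apply: memvZ.
exists u => //; apply: (semilinear_eigenbasis uz e1 e2 e3 fb).
have [i1 _ i2] := frame_mem fb; have [i3 _ i2'] := frame_mem fb'.
have r z : eig M z -> reflection u z = z by move=> /hu/on_lineP; apply.
move=> m; rewrite !inE => /or3P[] /eqP->.
- apply: (gconj_eigenvector (proj2 e1) (proj2 e1) (r _ h1)).
  by rewrite -(proj1 fb); apply: (proj1 cb).
- apply: (gconj_eigenvector (proj2 e2) (proj2 e2) (r _ h2)).
  by apply: (flag2_cap uz e1 e2 e3 fb fb'); [apply: (proj2 cb)|apply: (proj2 cb')].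
- apply: (gconj_eigenvector (proj2 e3) (proj2 e3) (r _ h3)).
  by rewrite -(proj1 fb'); apply: (proj1 cb').
Qed.

(** Sending [b] to [b'] is enough, as the involution then sends [b'] back to [b]. It exchanges the
    directions of [m1] and [m3] and preserves that of [m2], as the reflection does with the
    eigenvalues. *)
Lemma elliptic_criterion g M b b' :
  elliptic M -> generic_eigenvalues M -> eigenflag_pair M b b' ->
  in_PGL_real ((\pi_(PGL K 3) g)^-1 * M * \pi_(PGL K 3) g)%g <->
  fconj (val g) b b'.
Proof.
move=> ell [_ _ gen] [z1 [z2 [z3 [m1 [m2 [m3 [uz [e1 e2 e3] /(_ ell) pr fb fb']]]]]]].
have [u [u0 u13 l2]] := pr.
have [h1 h2 h3] : [/\ eig M z1, eig M z2 & eig M z3].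
  by split; [exact: eigenvector_eig e1|exact: eigenvector_eig e2|exact: eigenvector_eig e3].
have [n12 n13 n23] := eigenvalues_neq uz.
have u31 : reflection u z3 = z1 by rewrite -u13 reflectionK.
have u2 : reflection u z2 = z2 by apply/on_lineP.
rewrite in_PGL_realP; split=> [[c c0 hc]|cb].
  have cu : compatible_line M u.
    split=> // z; case/(eigenvalue_cases uz e1 e2 e3 fb) => ->.
    - by right; exists z3; rewrite eq_sym.
    - by left.
    - by right; exists z1.
  have cc := compatible_eigenbasis uz e1 e2 e3 fb c0 hc.
  have sE z m : eigenvector M z m ->
      mx_of M *m gconj (val g) m = reflection c z *: gconj (val g) m.
    by move=> em; rewrite hc (proj2 em) gconjZ scalerA.
  have c2 : reflection c z2 = z2 by apply/on_lineP => //; apply/(gen _ _ cu cc _ h2).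
  (* Were [z1] on the line of [c], genericity would put it on the line of [u] too, whereas the
     reflection about that line moves it to [z3]. *)
  have c1 : reflection c z1 != z1.
    apply/eqP => /(on_lineP _ c0)/(gen _ _ cu cc _ h1)/(on_lineP _ u0).
    by rewrite u13 => e; rewrite e eqxx in n13.
  (* The image of [z1] is an eigenvalue other than [z1], and not [z2], which is its own image. *)
  have c13 : reflection c z1 = z3.
    have hr : eig M (reflection c z1).
      apply: (eigenvector_eig (m := gconj (val g) m1)); split; last exact: sE.
      by apply: gconj_neq0 (valP g) _; case: e1.
    case: (eigenvalue_cases uz e1 e2 e3 fb hr) => // e; first by rewrite e eqxx in c1.
    by move: n12; rewrite -[z1](reflectionK c0) e c2 eqxx.
  have [_ _ s1] := eigenspace_line uz e1 e2 e3 fb (gconj (val g) m1).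
  have [_ s2 _] := eigenspace_line uz e1 e2 e3 fb (gconj (val g) m2).
  have [_ _ i2'] := frame_mem fb'.
  apply: (frame_fconj fb).
    by rewrite (proj1 fb'); apply: s1; rewrite (sE _ _ e1) c13.
  have : gconj (val g) m2 \in <[m2]>%VS by apply: s2; rewrite (sE _ _ e2) c2.
  by case/vlineP => k ->; apply: memvZ.
have cb' := fconj_sym (valP g) cb.
exists u => //; apply: (semilinear_eigenbasis uz e1 e2 e3 fb).
have [i1 _ i2] := frame_mem fb; have [i3 _ i2'] := frame_mem fb'.
move=> m; rewrite !inE => /or3P[] /eqP->.
- apply: (gconj_eigenvector (proj2 e1) (proj2 e3) u13).
  by rewrite -(proj1 fb'); apply: (proj1 cb).
- apply: (gconj_eigenvector (proj2 e2) (proj2 e2) u2).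
  by apply: (flag2_cap uz e1 e2 e3 fb fb'); [apply: (proj2 cb')|apply: (proj2 cb)].
- apply: (gconj_eigenvector (proj2 e3) (proj2 e1) u31).
  by rewrite -(proj1 fb); apply: (proj1 cb').
Qed.

End Criterion.

(** * The criterion for the whole collection *)

Theorem theorem7 (R : realType) (m n : nat) (hm : (1 < m)%N)
    (H : 'I_m -> PGL R[i] 3) (E : 'I_n -> PGL R[i] 3)
    (A B C D : flag R[i])
    (bH bH' : 'I_m -> flag R[i]) (bE bE' : 'I_n -> flag R[i]) :
  (forall i, hyperbolic (H i) /\ generic_eigenvalues (H i)) ->
  (forall i, elliptic (E i) /\ generic_eigenvalues (E i)) ->
  eigenflag_pair (H (Ordinal (ltnW hm))) A C ->
  eigenflag_pair (H (Ordinal hm)) B D ->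
  generic_position [tuple A; B; C; D] ->
  (forall i : 'I_m, (1 < i)%N ->
    [/\ eigenflag_pair (H i) (bH i) (bH' i),
        generic_position [tuple A; bH i; C; D]
      & generic_position [tuple A; bH' i; C; D]]) ->
  (forall i : 'I_n,
    [/\ eigenflag_pair (E i) (bE i) (bE' i),
        generic_position [tuple A; bE i; C; D]
      & generic_position [tuple A; bE' i; C; D]]) ->
  (exists G : PGL R[i] 3,
    (forall i, in_PGL_real (G^-1 * H i * G)%g) /\
    (forall i, in_PGL_real (G^-1 * E i * G)%g))
  <->
  [/\ (* (a) *)
      (flag_cross_ratio 1 0 A B C D \is Num.real) /\
      (flag_cross_ratio 0 1 A B C D \is Num.real),
      (* (b) *)
      (triple_ratio A B C \is Num.real) /\
      (triple_ratio A C D \is Num.real),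
      forall i : 'I_m, (1 < i)%N ->
        [/\ (* (c) *)
            (flag_cross_ratio 1 0 A (bH i) C D \is Num.real) /\
            (flag_cross_ratio 0 1 A (bH i) C D \is Num.real),
            (* (d) *)
            (flag_cross_ratio 1 0 A (bH' i) C D \is Num.real) /\
            (flag_cross_ratio 0 1 A (bH' i) C D \is Num.real)
          & (* (e) *)
            (triple_ratio A (bH i) C \is Num.real) /\
            (triple_ratio A (bH' i) C \is Num.real)]
    & forall i : 'I_n,
        [/\ (* (f) *)
            flag_cross_ratio 1 0 A (bE i) C D =
              (flag_cross_ratio 1 0 A (bE' i) C D)^*,
            flag_cross_ratio 0 1 A (bE i) C D =
              (flag_cross_ratio 0 1 A (bE' i) C D)^*
          & (* (g) *)
            triple_ratio A (bE i) C = (triple_ratio A (bE' i) C)^*]].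
Proof.
move=> hypH ellE pAC pBD gABCD flH flE.
pose i0 := Ordinal (ltnW hm); pose i1 := Ordinal hm.
have critH i b b' g := hyperbolic_criterion g (b := b) (b' := b')
  (proj1 (hypH i)) (proj2 (hypH i)).
have critE i b b' g := elliptic_criterion g (b := b) (b' := b')
  (proj1 (ellE i)) (proj2 (ellE i)).
split=> [[G [realH realE]]|[[a10 a01] [bB bD] condH condE]].
  have [g eG] : exists g, G = (\pi_(PGL R[i] 3) g)%qT by exists (repr G); rewrite reprK.
  have ug := valP g; rewrite eG in realH realE.
  have [cA cC] := (critH i0 _ _ g pAC).1 (realH i0).
  have [cB cD] := (critH i1 _ _ g pBD).1 (realH i1).
  (* A flag fixed by the involution has invariants equal to their own conjugates. *)
  have real10 b : fconj (val g) b b -> flag_cross_ratio 1 0 A b C D \is Num.real.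
    by move=> cb; apply/CrealP/esym/(cross_ratio10_conj ug cA cb cC cD).
  have real01 b : fconj (val g) b b -> flag_cross_ratio 0 1 A b C D \is Num.real.
    by move=> cb; apply/CrealP/esym/(cross_ratio01_conj ug cA cb cC cD).
  have realT b : fconj (val g) b b -> triple_ratio A b C \is Num.real.
    by move=> cb; apply/CrealP/esym/(triple_ratio_conj ug cA cb cC).
  split.
  - by split; [exact: real10|exact: real01].
  - split; first exact: realT.
    by apply/CrealP/esym/(triple_ratio_conj ug cA cC cD).
  - move=> i hi; have [pf _ _] := flH i hi.
    have [cb cb'] := (critH i _ _ g pf).1 (realH i).
    split; split; [exact: real10 cb|exact: real01 cb|exact: real10 cb'
      |exact: real01 cb'|exact: realT cb|exact: realT cb'].
  - move=> i; have [pf _ _] := flE i.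
    (* Reversed, because (f) and (g) express the invariants of [bE i] by those of [bE' i]. *)
    have cb := fconj_sym ug ((critE i _ _ g pf).1 (realE i)).
    split; first exact: cross_ratio10_conj ug cA cb cC cD.
    + exact: cross_ratio01_conj ug cA cb cC cD.
    + exact: triple_ratio_conj ug cA cb cC.
(* By (b), [triple_ratio A C D] is real, which makes the involution fix the plane of [D]. *)
have [G uG [cA cC cD rec]] := real_structure_exists gABCD (conj_Creal bD).
have rec1 b : generic_position [tuple A; b; C; D] ->
    flag_cross_ratio 1 0 A b C D \is Num.real ->
    flag_cross_ratio 0 1 A b C D \is Num.real ->
    triple_ratio A b C \is Num.real -> fconj G b b.
  move=> gb r10 r01 rT; apply: rec gb _ _ _.
  - exact: esym (conj_Creal r10).
  - exact: esym (conj_Creal r01).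
  - exact: esym (conj_Creal rT).
pose g : GL R[i] 3 := exist (fun M : 'M_3 => M \in unitmx) G uG.
exists (\pi_(PGL R[i] 3) g)%qT; split=> i.
  (* The first two elements carry the normalizing flags: [A], [C], [D] are fixed by construction and
     [B] by (a) and (b). Conditions (c)-(e) settle the other indices. *)
  have [ei|ni0] := eqVneq i i0.
    by rewrite ei; apply/(critH i0 _ _ g pAC).
  have [ei|ni1] := eqVneq i i1.
    by rewrite ei; apply/(critH i1 _ _ g pBD); split=> //; apply: rec1 a10 a01 bB.
  have hi : (1 < i)%N.
    by move: ni0 ni1; rewrite -!val_eqE /=; case: (val i) => [|[|]].
  have [pf gb gb'] := flH i hi; have [[c1 c2] [d1 d2] [t1 t2]] := condH i hi.
  apply/(critH i _ _ g pf); split.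
    exact: rec1 gb c1 c2 t1.
  exact: rec1 gb' d1 d2 t2.
(* Conjugating (f) and (g) gives the invariants of [bE' i] from those of [bE i], the form in which
   [rec] takes them. *)
have [pf _ gb'] := flE i; have [f1 f2 f3] := condE i.
apply/(critE i _ _ g pf); apply: rec gb' _ _ _.
- by rewrite f1 conjCK.
- by rewrite f2 conjCK.
- by rewrite f3 conjCK.
Qed.
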